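(* For a rooted pointed quadrangulation $Q$ of the sphere with $N\ge1$ faces, let $d(v)$ be the graph distance of a vertex $v$ to the origin and apply Schaeffer's prescription to the labeling $\ell=-d$. The resulting planar map $\Phi(Q)$ contains the origin, which we take as its distinguished vertex, and is rooted at the corner, at the endpoint $v$ of the root edge of $Q$ with smaller distance $d(v)$, into which the root edge of $Q$ points. Then $\Phi$ is a bijection from the set $\mathcal{Q}$ of rooted pointed quadrangulations of the sphere onto the set $\mathcal{M}$ of rooted pointed planar maps with at least one edge, and: (i) the number of edges of $\Phi(Q)$ equals the number of faces of $Q$; (ii) the number of faces of $\Phi(Q)$ equals the number of local maxima of the distance labeling $d$ on $Q$; (iii) the graph distance in $\Phi(Q)$ from the origin to the root vertex equals the distance in $Q$ from the origin to the closer endpoint of the root edge. Consequently, for all $N,n,t$, the number of rooted pointed planar maps with $N$ edges, $n$ faces and root vertex at distance $t$ from the origin equals the number of rooted pointed quadrangulations with $N$ faces, exactly $n$ local maxima of the distance labeling, and root edge whose closer endpoint is at distance $t$ from the origin.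
   Context: A planar map is a connected multigraph embedded in the oriented 2-sphere without crossings, up to orientation-preserving deformation; a quadrangulation is a planar map with all faces of degree 4. A rooted pointed quadrangulation is a quadrangulation with a distinguished vertex (the origin) and a marked unoriented edge (root edge). A rooted pointed planar map is a planar map with a distinguished vertex (origin) and a marked corner (root corner, whose vertex is the root vertex). A local maximum of the distance labeling is a vertex all of whose neighbours are strictly closer to the origin (equivalently, whose distance is $\ge$ that of all neighbours). Schaeffer's prescription, for vertex labels $\ell$ differing by exactly one along edges: each face has cyclic labels $(t-1,t,t+1,t)$ (simple) or $(t+1,t,t+1,t)$ (confluent); inside each confluent face draw the diagonal joining the two corners labelled $t+1$; inside each simple face draw an edge parallel to the side joining the corner labelled $t+1$ to the next corner in clockwise order; discard the original edges and keep the vertices incident to new edges. *)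

(* Defs.v *)
(* Planar maps are encoded as combinatorial maps (rotation
   systems). *)
From mathcomp Require Import all_boot all_fingroup.
Set Implicit Arguments. Unset Strict Implicit. Unset Printing Implicit Defensive.

(* A (candidate) rooted pointed map on the dart set 'I_k:
   (sigma, alpha, root dart, origin dart).
   sigma = counterclockwise rotation of darts around their vertex,
   alpha = the other half of the same edge.
   The vertex of a dart d is the sigma-orbit of d; the origin vertex is the
   sigma-orbit of the origin dart.  For general maps the root dart d represents
   the root corner lying between d and sigma d (counterclockwise); for
   quadrangulations the root dart d represents the unoriented root edge
   {d, alpha d}. *)
Notation rpmap k := ({perm 'I_k} * {perm 'I_k} * 'I_k * 'I_k)%type.

Definition sg k (A : rpmap k) : {perm 'I_k} := A.1.1.1.
Definition al k (A : rpmap k) : {perm 'I_k} := A.1.1.2.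
Definition rt k (A : rpmap k) : 'I_k := A.1.2.
Definition og k (A : rpmap k) : 'I_k := A.2.

(* face permutation: fphi d = sigma^-1 (alpha d) (note (s * t) x = t (s x));
   the corner of d (between d and sigma d) belongs to the face of d, and fphi
   walks around each face counterclockwise (face on the left). *)
Definition fphi k (A : rpmap k) : {perm 'I_k} := (al A * (sg A)^-1)%g.

Definition nvertices k (A : rpmap k) : nat := #|porbits (sg A)|.
Definition nedges k (A : rpmap k) : nat := #|porbits (al A)|.
Definition nfaces k (A : rpmap k) : nat := #|porbits (fphi A)|.

(* connected planar map: alpha a fixed-point-free involution, <sigma,alpha>
   transitive, Euler formula V - E + F = 2 with E = k/2. *)
Definition is_map k (A : rpmap k) : bool :=
  [forall d, (al A (al A d) == d) && (al A d != d)] &&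
  [forall x, forall y, connect (fun a b : 'I_k => (b == sg A a) || (b == al A a)) x y] &&
  (2 * (nvertices A + nfaces A) == k + 4).

Definition is_quad k (A : rpmap k) : bool :=
  is_map A && [forall d, #|porbit (fphi A) d| == 4].

Fixpoint ball k (A : rpmap k) (n : nat) : {set 'I_k} :=
  match n with
  | 0 => porbit (sg A) (og A)
  | n'.+1 => ball A n' :|:
             [set d | [exists e in ball A n', d \in porbit (sg A) (al A e)]]
  end.

Definition dist k (A : rpmap k) (d : 'I_k) : nat :=
  find (fun n => d \in ball A n) (iota 0 k).

Definition nlocmax k (A : rpmap k) : nat :=
  #|[set O in porbits (sg A) | [forall d in O, dist A (al A d) < dist A d]]|.

(* Corners of Q are identified with darts (corner of d = between d and sigma d).
   A corner labelled t+1 (i.e. of minimal distance in its face) is exactly a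
   corner whose two neighbours in the face have larger distance. *)
Definition isMin k (A : rpmap k) (c : 'I_k) : bool :=
  (dist A c < dist A (fphi A c)) && (dist A c < dist A (((fphi A)^-1)%g c)).

(* corners receiving an end of a new edge: every t+1 corner, and in a simple
   face the next corner clockwise (= fphi^-1) after its t+1 corner. *)
Definition endc k (A : rpmap k) (c : 'I_k) : bool :=
  isMin A c || (isMin A (fphi A c) && ~~ isMin A (fphi A (fphi A (fphi A c)))).

Definition partner k (A : rpmap k) (c : 'I_k) : 'I_k :=
  if isMin A c then
    (if isMin A (fphi A (fphi A c)) then fphi A (fphi A c)   (* confluent *)
     else ((fphi A)^-1)%g c)                                     (* simple *)
  else fphi A c.

Definition nextE k (A : rpmap k) (c : 'I_k) : 'I_k :=
  let j := find (fun j => endc A (((sg A) ^+ j.+1)%g c)) (iota 0 k) in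
  (((sg A) ^+ j.+1)%g c).

Definition prevE k (A : rpmap k) (r : 'I_k) : 'I_k :=
  let j := find (fun j => endc A ((((sg A)^-1) ^+ j.+1)%g r)) (iota 0 k) in
  ((((sg A)^-1) ^+ j.+1)%g r).

Definition rootLow k (A : rpmap k) : 'I_k :=
  if dist A (rt A) < dist A (al A (rt A)) then rt A else al A (rt A).

(* the root of Phi(Q): the corner of Phi(Q), at the closer endpoint v of the
   root edge, into which the root edge of Q points *)
Definition rootPhi k (A : rpmap k) : 'I_k := prevE A (rootLow A).

(* M is (a presentation of) Phi(Q): its darts are in bijection f with the
   end-corners of Q, its rotation is the cyclic order of those ends around each
   vertex, its edges are the new edges, the root is rootPhi Q and the
   distinguished vertex is the origin of Q. *)
Definition PhiRel k m (Q : rpmap k) (M : rpmap m) : Prop :=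
  exists f : 'I_m -> 'I_k,
    [/\ injective f,
        (forall c, endc Q c -> exists d, f d = c),
        (forall d, endc Q (f d)),
        (forall d, f (sg M d) = nextE Q (f d)) &
     [/\
        (forall d, f (al M d) = partner Q (f d)),
        f (rt M) = rootPhi Q
      & f (og M) \in porbit (sg Q) (og Q)]].

Definition isoMap k k' (A : rpmap k) (B : rpmap k') : bool :=
  (k == k') &&
  [exists f : {ffun 'I_k -> 'I_k'},
    [&& injectiveb f,
        [forall d, (f (sg A d) == sg B (f d)) && (f (al A d) == al B (f d))],
        f (rt A) == rt B
      & f (og A) \in porbit (sg B) (og B)]].

Definition isoQuad k k' (A : rpmap k) (B : rpmap k') : bool :=
  (k == k') &&
  [exists f : {ffun 'I_k -> 'I_k'},
    [&& injectiveb f,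
        [forall d, (f (sg A d) == sg B (f d)) && (f (al A d) == al B (f d))],
        (f (rt A) == rt B) || (f (rt A) == al B (rt B))
      & f (og A) \in porbit (sg B) (og B)]].

Definition nclasses k (P : pred (rpmap k)) (R : rpmap k -> rpmap k -> bool) : nat :=
  #|[set [set y | P y && R x y] | x in [set x | P x]]|.

(* Main.v *)
(* Proof idea.  By planarity (Euler's formula and linear algebra mod 2) the labels
   d differ by exactly one along the edges of Q, so every edge of Q has a unique
   increasing dart.  A corner carries an end of a new edge exactly when the next
   dart counterclockwise is increasing; hence the darts of Phi(Q) are the
   increasing darts of Q.  Around a face of Phi(Q) the labels vary by at most 1
   per step, and an increasing dart u of Q, followed from its corner of Phi(Q),
   ends at the first later corner of the same face with a larger label, or at a
   local maximum of d if there is none.  This puts the faces of Phi(Q) in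
   bijection with the local maxima of d, and it is also the recipe which rebuilds
   Q from Phi(Q): every corner of a pointed map is linked to its successor in its
   face, and the corners of maximal label to a new vertex inside the face. *)
Require Import Defs.
From mathcomp Require Import all_boot all_fingroup.
From mathcomp Require Import all_algebra zify.
Set Implicit Arguments. Unset Strict Implicit. Unset Printing Implicit Defensive.

(** * Orbits and first returns of a permutation *)

(** The end-corners of Q are replaced by the increasing darts that follow them. The map [g] from the
    darts of M to those darts turns Schaeffer's drawing rule into a local formula [new_edge], and
    the rotation of M into the first return to increasing darts. First returns form an inductive
    relation [fret], so that comparing searches along an orbit becomes induction. Euler's formula
    enters twice: it makes Q bipartite, and it is carried between Q and M by counting orbits. In
    between, only the local properties collected in [dist_quad] are used, so the inverse
    construction needs no argument about embeddings. Distances are certified by local conditions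
    ([geodesic]) rather than computed. Hence the labels of Q, read on M, are the distances of M. M
    alone then determines the labels, which is why Q can be recovered from it. *)

Section Porbits.
Variable T : finType.
Implicit Types (s : {perm T}) (x y : T).

Lemma porbit_step s x : s x \in porbit s x.
Proof. exact: (mem_porbit s 1). Qed.

Lemma porbit_trans s y x z : y \in porbit s x -> z \in porbit s y -> z \in porbit s x.
Proof. by rewrite -!eq_porbit_mem => /eqP <-. Qed.

Lemma porbit_ind s (K : T -> Prop) :
  (forall x, K x -> K (s x)) -> forall x y, K x -> y \in porbit s x -> K y.
Proof.
move=> Ks x y Kx /porbitP[i ->]; elim: i => [|i IH]; first by rewrite perm1.
by rewrite expgSr permM; apply: Ks.
Qed.

Lemma porbit_const (R : Type) s (L : T -> R) :
  (forall x, L (s x) = L x) -> forall x y, y \in porbit s x -> L y = L x.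
Proof.
by move=> Ls x y; apply: (porbit_ind (K := fun z => L z = L x)) => // z; rewrite Ls.
Qed.

Lemma card_porbits_uniform s n :
  (forall x, #|porbit s x| = n) -> #|porbits s| * n = #|T|.
Proof.
move=> sn; have part : partition (porbits s) [set: T].
  apply/and3P; split.
  - apply/eqP/setP => x; rewrite inE; apply/bigcupP; exists (porbit s x) => //.
      exact: imset_f.
    exact: porbit_id.
  - apply/trivIsetP => _ _ /imsetP[x _ ->] /imsetP[y _ ->] nxy.
    apply/pred0P => z /=; apply/negbTE; apply: contra nxy => /andP[zx zy].
    by rewrite -!eq_porbit_mem in zx zy; rewrite -(eqP zx).
  - apply/imsetP => [[x _ x0]]; have := porbit_id s x.
    by rewrite -x0 inE.
rewrite -cardsT -(card_uniform_partition _ part) // => A /imsetP[x _ ->].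
exact: sn.
Qed.

Lemma card_porbit2 s x : s (s x) = x -> s x != x -> #|porbit s x| = 2.
Proof.
move=> ssx sx; suff -> : porbit s x = [set x; s x] by rewrite cards2 eq_sym sx.
apply/setP => y; rewrite !inE; apply/idP/orP.
  apply: (porbit_ind (K := fun y => y == x \/ y == s x)); last by left.
  by move=> z [] /eqP->; [right | left]; rewrite ?ssx.
by case=> /eqP ->; [exact: porbit_id | exact: porbit_step].
Qed.

Lemma card_porbit4P s x :
  reflect (s (s (s (s x))) = x /\ s (s x) <> x) (#|porbit s x| == 4).
Proof.
apply: (iffP eqP) => [c4|[s4 s2]].
  split; first by have := iter_porbit s x; rewrite c4.
  by have := uniq_traject_porbit s x; rewrite c4 /= !inE !negb_or;
     case/and4P => /and3P[_ /eqP ns2 _] _ _ _ s2; apply: ns2.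
have s1 : s x <> x by move=> s1; apply: s2; rewrite !s1.
have s3 : s (s (s x)) <> x by move=> s3; apply: s1; rewrite -{1}s3 s4.
suff -> : porbit s x = [set:: [:: x; s x; s (s x); s (s (s x))]].
  rewrite cardsE (card_uniqP _) //= !inE !negb_or !(inj_eq perm_inj).
  by rewrite !(eq_sym x); apply/and4P; split=> //;
    do ?[apply/and3P; split|apply/andP; split]; apply/eqP.
apply/setP => y; rewrite inE; apply/idP/idP.
  apply: (porbit_ind (K := fun y => y \in _)); last by rewrite !inE eqxx.
  move=> z; rewrite !inE => /or4P[]/eqP->; rewrite ?s4 ?eqxx ?orbT //.
by rewrite !inE => /or4P[]/eqP->; rewrite ?porbit_id //;
   do ?[apply: porbit_trans (porbit_step _ _)]; rewrite ?porbit_id.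
Qed.

End Porbits.

Section FirstReturn.
Variable T : finType.
Implicit Types (s : {perm T}) (P : pred T) (x y z : T).

(* [y] is the first point of [P] among [s x], [s (s x)], ... *)
Inductive fret s P : T -> T -> Prop :=
| FretHit x : P (s x) -> fret s P x (s x)
| FretSkip x y : ~~ P (s x) -> fret s P (s x) y -> fret s P x y.

Lemma fret_in s P x y : fret s P x y -> P y.
Proof. by elim. Qed.

Lemma fret_porbit s P x y : fret s P x y -> y \in porbit s x.
Proof.
elim=> [z _|z t _ _ IH]; first exact: porbit_step.
exact: porbit_trans (porbit_step s z) IH.
Qed.

Lemma fret_fun s P x y z : fret s P x y -> fret s P x z -> y = z.
Proof.
move=> xy; elim: xy z => {x y} [x Px|x y Px _ IH] z xz.
  by inversion xz; subst=> //; rewrite Px in H.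
by inversion xz; subst; [rewrite H in Px | exact: IH].
Qed.

Lemma fretP s P x y :
  fret s P x y <-> exists n, [/\ y = (s ^+ n.+1)%g x, P y
                            & forall i, i < n -> ~~ P ((s ^+ i.+1)%g x)].
Proof.
split=> [|[n [-> {y}]]].
  move=> xy; elim: xy => {x y} [x Px|x y Px _ [n [-> Py Pn]]].
    by exists 0; rewrite expg1; split.
  exists n.+1; split; rewrite ?(expgS s n.+1) ?permM //.
  by case=> [|i] in_; rewrite ?expg1 // expgS permM; apply: Pn.
elim: n x => [|n IH] x; first by rewrite expg1 => Px _; exact: FretHit.
rewrite expgS permM => Py Pn; apply: FretSkip.
  by have := Pn 0 isT; rewrite expg1.
by apply: IH => // i in_; rewrite -permM -expgS; apply: Pn.
Qed.

Lemma fret_exists s P x y : y \in porbit s x -> P y -> exists z, fret s P x z.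
Proof.
have [x' ->] : exists x', x = s x' by exists ((s^-1)%g x); rewrite permKV.
have -> : porbit s (s x') = porbit s x' by apply/eqP; rewrite eq_porbit_mem porbit_step.
move=> yx' Py; have {yx'} : y \in porbit s (s (s x')).
  apply: porbit_trans yx'; rewrite porbit_sym.
  exact: porbit_trans (porbit_step _ _) (porbit_step _ _).
case/porbitP => i; elim: i (s x') => [|i IH] {}x.
  by rewrite perm1 => yx; exists (s x); apply: FretHit; rewrite -yx.
have [Px|Px] := boolP (P (s x)); first by exists (s x); apply: FretHit.
by rewrite expgS permM => /IH[z xz]; exists z; apply: FretSkip.
Qed.

(** No point of [P] lies strictly between [x] and [y], so a backward search from [y] stops at [x].
    This exchanges clockwise and counterclockwise statements. *)
Lemma fret_inv s P x y : fret s P x y -> P x -> fret (s^-1)%g P y x.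
Proof.
have gen z : fret s P x y -> (P x -> z = x) -> (~~ P x -> fret (s^-1)%g P x z) ->
    fret (s^-1)%g P y z.
  move=> xy; elim: xy => {x y} [x Pxs|x y Pxs _ IH] zP zN.
    rewrite -{2}[x](permK s) in zN *.
    have [Px|Px] := boolP (P x).
      by rewrite (zP Px) -{2}[x](permK s); apply: FretHit; rewrite permK.
    by apply: FretSkip; rewrite ?permK //; have := zN Px; rewrite permK.
  apply: IH => [Psx|_]; first by rewrite Psx in Pxs.
  have [Px|Px] := boolP (P x).
    by rewrite (zP Px) -{2}[x](permK s); apply: FretHit; rewrite permK.
  by apply: FretSkip; rewrite permK //; apply: zN.
by move=> xy Px; apply: gen xy _ _ => //; rewrite Px.
Qed.

Lemma fret_inj s P x x' y : P x -> P x' -> fret s P x y -> fret s P x' y -> x = x'.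
Proof. by move=> Px Px' /fret_inv/(_ Px) xy /fret_inv/(_ Px'); apply: fret_fun. Qed.

Lemma fret_sub s P P' x y z : subpred P' P ->
  fret s P x y -> ~~ P' y -> fret s P' y z -> fret s P' x z.
Proof.
move=> sub; move=> xy; elim: xy => {x y} [x _|x y Px _ IH] nP yz; first exact: FretSkip.
by apply: FretSkip; [apply: contra (sub _) Px | apply: IH].
Qed.

Lemma eq_fret s P P' x y : P =1 P' -> fret s P x y -> fret s P' x y.
Proof.
move=> eqP; move=> xy; elim: xy => {x y} [x Px|x y Px _ IH]; first by apply: FretHit; rewrite -eqP.
by apply: FretSkip; rewrite -?eqP.
Qed.

(** An induction principle for orbits observed only at the points of [P]. The invariant, which makes
    sense at every point, is that the next point of [P] lies in [K]. *)
Lemma fret_closed s P (K : T -> Prop) :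
    (forall x, K x -> exists2 y, K y & fret s P x y) ->
  forall x y, K x -> y \in porbit s x -> P y -> K y.
Proof.
move=> Kret x y Kx yx.
suff [] : (exists2 z, K z & fret s P y z) /\ (P y -> K y) by [].
pose K' y := (exists2 z, K z & fret s P y z) /\ (P y -> K y).
apply: (porbit_ind (K := K') _ _ yx) => [u [[z Kz uz] _]|]; last first.
  by split=> //; apply: Kret.
inversion uz; subst; first by split=> //; apply: Kret.
by split; [exists z | rewrite (negbTE H)].
Qed.

Lemma fret_before s P x z : ~~ P x -> z \in porbit s x -> P z ->
  exists y, [/\ fret s P x y & ~~ P ((s^-1)%g y)].
Proof.
move=> nPx /fret_exists /[apply] -[y xy]; exists y; split=> //.
by elim: xy nPx => {y x} [x _|x y Px _ IH] nPx; [rewrite permK | exact: IH].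
Qed.

End FirstReturn.

Lemma fret_morph (T T' : finType) (s : {perm T}) (s' : {perm T'}) P P' (h : T -> T') :
    (forall x, h (s x) = s' (h x)) -> (forall x, P' (h x) = P x) ->
  forall x y, fret s P x y -> fret s' P' (h x) (h y).
Proof.
move=> hs hP x y; move=> xy; elim: xy => {x y} [x Px|x y Px _ IH].
  by rewrite hs; apply: FretHit; rewrite -hs hP.
by apply: FretSkip; rewrite -hs ?hP.
Qed.

(** Functions with the same fibres have equinumerous images. Orbits of different maps are counted
    against each other this way, without an explicit bijection. *)
Lemma card_imset_eq (I A B : finType) (D : {set I}) (f : I -> A) (h : I -> B) :
    {in D &, forall x y, (f x == f y) = (h x == h y)} ->
  #|f @: D| = #|h @: D|.
Proof.
have leq (A' B' : finType) (f' : I -> A') (h' : I -> B') :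
    {in D &, forall x y, (f' x == f' y) = (h' x == h' y)} -> #|f' @: D| <= #|h' @: D|.
  move=> fh; have [->|[x0 Dx0]] := set_0Vmem D; first by rewrite !imset0 !cards0.
  pose k b := f' (odflt x0 [pick x in D | h' x == b]).
  suff /subset_leq_card : f' @: D \subset k @: (h' @: D).
    by move/leq_trans; apply; apply: leq_imset_card.
  apply/subsetP => _ /imsetP[x Dx ->]; apply/imsetP; exists (h' x); first exact: imset_f.
  rewrite /k; case: pickP => [y /andP[Dy hy]|/(_ x)] /=; last by rewrite Dx eqxx.
  by apply/eqP; rewrite fh // eq_sym.
by move=> fh; apply/eqP; rewrite eqn_leq !leq //= => x y Dx Dy; rewrite fh.
Qed.

(** * Distance labelings *)

(** A local certificate for graph distance: the upper bound comes from the descent condition, the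
    lower bound from the Lipschitz condition. It can be checked on labels transported from another
    map. *)
Definition geodesic k (A : rpmap k) (L : 'I_k -> nat) : Prop :=
  [/\ forall d, L (sg A d) = L d,
      forall d, L (al A d) <= (L d).+1,
      forall d, (L d == 0) = (d \in porbit (sg A) (og A))
    & forall d, 0 < L d -> exists2 e, e \in porbit (sg A) d & L (al A e) < L d].

Definition linked k (A : rpmap k) : rel 'I_k :=
  connect (fun a b => (b == sg A a) || (b == al A a)).

Lemma find_iota (p : pred nat) m n :
  m < n -> p m -> (forall i, i < m -> ~~ p i) -> find p (iota 0 n) = m.
Proof.
move=> mn pm np; have -> : n = m + (n - m).-1.+1 by lia.
rewrite iotaD find_cat /= add0n pm addn0 size_iota.
by rewrite ifN //; apply/hasPn => i; rewrite mem_iota => /np.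
Qed.

Section Distance.
Variables (k : nat) (A : rpmap k).
Hypothesis alK : forall d, al A (al A d) = d.

Lemma ball_geodesic L n : geodesic A L -> ball A n = [set d | L d <= n].
Proof.
case=> Ls La L0 Ldown; have Lorb := porbit_const Ls.
elim: n => [|n IH] /=; first by apply/setP=> d; rewrite inE leqn0 L0.
apply/setP=> d; rewrite !inE IH inE; apply/orP/idP => [[|/exists_inP[e]]|].
- exact: leqW.
- by rewrite inE => Le /Lorb ->; apply: leq_trans (La e) _.
rewrite leq_eqVlt ltnS => /orP[/eqP Ld|]; [right | by left].
have [|e de Le] := Ldown d; first by rewrite Ld.
apply/exists_inP; exists (al A e); first by rewrite inE -ltnS -Ld.
by rewrite alK porbit_sym.
Qed.

(** Descending from [d] meets every value up to [L d], each on a different dart. The bound matters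
    because [dist] searches only below [k]. *)
Lemma geodesic_lt L d : geodesic A L -> L d < k.
Proof.
case=> Ls La L0 Ldown; have Lorb := porbit_const Ls.
have reach n : n <= L d -> exists e, L e == n.
  move=> nd; rewrite -(subKn nd); elim: (L d - n) => [|i [e /eqP Le]].
    by exists d; rewrite subn0.
  have [di|id] := leqP (L d) i; first by exists e; rewrite Le; apply/eqP; lia.
  have [|f fe Lf] := Ldown e; first by rewrite Le subn_gt0.
  exists (al A f); apply/eqP; have := La (al A f); rewrite alK (Lorb _ _ fe) Le.
  by move: Lf; rewrite Le; lia.
have sub : {subset iota 0 (L d).+1 <= [seq L e | e <- enum 'I_k]}.
  move=> n; rewrite mem_iota add0n ltnS => /reach[e /eqP <-].
  by rewrite map_f ?mem_enum.
by have := uniq_leq_size (iota_uniq 0 _) sub; rewrite size_map size_iota size_enum_ord.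
Qed.

Lemma geodesic_dist L : geodesic A L -> dist A =1 L.
Proof.
move=> geo d; rewrite /dist; apply: find_iota; first exact: geodesic_lt.
  by rewrite (ball_geodesic _ geo) inE.
by move=> i; rewrite (ball_geodesic _ geo) inE ltnNge.
Qed.

Lemma geodesic_linked L : geodesic A L -> forall x y, linked A x y.
Proof.
move=> [Ls La L0 Ldown]; have Lorb := porbit_const Ls.
have orb x y : y \in porbit (sg A) x -> linked A x y.
  apply: (porbit_ind (K := fun y => linked A x y)); last exact: connect0.
  by move=> z /connect_trans; apply; apply: connect1; rewrite eqxx.
have edge x : linked A x (al A x) by apply: connect1; rewrite eqxx orbT.
have toO x : linked A x (og A) /\ linked A (og A) x.
  have [n] := ubnP (L x); elim: n x => // n IH x Lx.
  have [/eqP|Lx0] := posnP (L x).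
    by rewrite L0 => xo; split; apply: orb; rewrite // porbit_sym.
  have [e ex Le] := Ldown x Lx0; have [|eo oe] := IH (al A e); first exact: leq_trans Le _.
  split; first by apply: connect_trans (connect_trans (edge e) eo); apply: orb.
  apply: connect_trans oe _; apply: connect_trans (edge _) _.
  by rewrite alK; apply: orb; rewrite porbit_sym.
by move=> x y; apply: connect_trans (toO x).1 (toO y).2.
Qed.

Lemma dist_geodesic : (forall x y, linked A x y) -> geodesic A (dist A).
Proof.
move=> conn.
have ballS n d : d \in ball A n -> sg A d \in ball A n.
  case: n => [|n] /=; first by move=> od; apply: porbit_trans od (porbit_step _ _).
  have gen : forall m e, e \in ball A m -> sg A e \in ball A m.
    elim=> [|m IH] e /=; first by move=> oe; apply: porbit_trans oe (porbit_step _ _).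
    rewrite !inE => /orP[/IH->//|/exists_inP[f fm ef]]; apply/orP; right.
    by apply/exists_inP; exists f => //; apply: porbit_trans ef (porbit_step _ _).
  exact: (gen n.+1).
have ballA n d : d \in ball A n -> al A d \in ball A n.+1.
  move=> dn; rewrite /= !inE; apply/orP; right; apply/exists_inP; exists d => //.
  exact: porbit_id.
have reach d : exists n, d \in ball A n.
  have /connectP[p pth ->] := conn (og A) d.
  have : exists n, og A \in ball A n by exists 0; rewrite /= porbit_id.
  elim: p (og A) pth => //= a p IH x /andP[xa pth] [n xn]; apply: IH pth _.
  by case/orP: xa => /eqP->; [exists n; apply: ballS | exists n.+1; apply: ballA].
(* The distance without the cutoff at [k]; it agrees with [dist] once it is known to be geodesic. *)
pose L d := ex_minn (reach d).
have Lle n d : (L d <= n) = (d \in ball A n).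
  rewrite /L; case: ex_minnP => m dm min; apply/idP/idP; last exact: min.
  by move/subnK <-; elim: (n - m) => // i IH; rewrite addSn /= inE IH.
suff geo : geodesic A L.
  have eqL := geodesic_dist geo; case: geo => Ls La L0 Ldown.
  split=> d; rewrite ?eqL //= => /Ldown[e de Le]; exists e => //.
  by rewrite !eqL.
have Ls_le d : L (sg A d) <= L d by rewrite Lle ballS // -Lle.
have Lorb d e : e \in porbit (sg A) d -> L e = L d.
  have le x y : y \in porbit (sg A) x -> L y <= L x.
    apply: (porbit_ind (K := fun y => L y <= L x)) => // z; exact: leq_trans (Ls_le z).
  by move=> de; apply/eqP; rewrite eqn_leq !le // porbit_sym.
split.
- by move=> d; apply: Lorb; apply: porbit_step.
- by move=> d; rewrite Lle ballA // -Lle.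
- by move=> d; rewrite -leqn0 Lle.
- move=> d Ld0; have : d \in ball A (L d).-1.+1 by rewrite -Lle prednK.
  rewrite /= inE -Lle leqNgt prednK // leqnn /= inE => /exists_inP[e].
  rewrite -Lle => Le de; exists (al A e); first by rewrite porbit_sym.
  by rewrite alK; lia.
Qed.

End Distance.

(** * Bipartiteness of planar maps with even faces *)

Section Incidence.
Variables (k : nat).
Implicit Types (s t : {perm 'I_k}) (d : 'I_k).

Definition orbit_index s d : 'I_#|porbits s| :=
  enum_rank_in (imset_f (porbit s) (isT : d \in predT)) (porbit s d).

Lemma orbit_index_eq s d e : (orbit_index s d == orbit_index s e) = (e \in porbit s d).
Proof.
rewrite porbit_sym -eq_porbit_mem; apply/eqP/eqP => [|de].
  by move/(congr1 enum_val); rewrite !enum_rankK_in ?imset_f.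
by apply: enum_val_inj; rewrite !enum_rankK_in ?imset_f.
Qed.

Lemma orbit_indexP s (i : 'I_#|porbits s|) : exists d, i = orbit_index s d.
Proof.
have /imsetP[d _ id] := enum_valP i; exists d.
by apply: enum_val_inj; rewrite enum_rankK_in ?imset_f.
Qed.

Import GRing.Theory.
Local Open Scope ring_scope.

(** Multiplied by the transposed incidence of the edge involution, this gives the mod 2 vertex-edge
    incidence matrix, or the face-edge one when [s] is the face permutation. *)
Definition incidence s : 'M['F_2]_(#|porbits s|, k) :=
  \matrix_(i, d) (i == orbit_index s d)%:R.

Lemma mul_incidence s (u : 'rV_#|porbits s|) d :
  (u *m incidence s) 0 d = u 0 (orbit_index s d).
Proof.
rewrite mxE (bigD1 (orbit_index s d)) //= big1 ?addr0 => [|i ni].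
  by rewrite mxE eqxx mulr1.
by rewrite mxE (negbTE ni) mulr0.
Qed.

Lemma mul_incidence_tr s (w : 'rV_k) d :
  (w *m (incidence s)^T) 0 (orbit_index s d) = \sum_(e in porbit s d) w 0 e.
Proof.
rewrite mxE [RHS]big_mkcond /=; apply: eq_bigr => e _; rewrite !mxE orbit_index_eq.
by case: ifP => _; rewrite ?mulr1 ?mulr0.
Qed.

Variable a : {perm 'I_k}.
Hypotheses (aK : forall d, a (a d) = d) (aN : forall d, a d != d).

Lemma sum_edge (w : 'rV['F_2]_k) d : \sum_(e in porbit a d) w 0 e = w 0 d + w 0 (a d).
Proof.
suff -> : porbit a d = [set d; a d].
  by rewrite big_setU1 ?big_set1 // inE eq_sym.
apply/setP=> e; rewrite !inE; apply/idP/orP.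
  apply: (porbit_ind (K := fun e => e == d \/ e == a d)); last by left.
  by move=> z [] /eqP->; [right | left]; rewrite ?aK.
by case=> /eqP->; [exact: porbit_id | exact: porbit_step].
Qed.

Lemma mul_edge_incidence s (u : 'rV_#|porbits s|) d :
  (u *m (incidence s *m (incidence a)^T)) 0 (orbit_index a d)
  = u 0 (orbit_index s d) + u 0 (orbit_index s (a d)).
Proof. by rewrite mulmxA mul_incidence_tr sum_edge !mul_incidence. Qed.

Lemma addF2 (x : 'F_2) : x + x = 0.
Proof. by rewrite -mulr2n -mulr_natl (_ : 2%:R = 0 :> 'F_2) ?mul0r //; apply/eqP. Qed.

(** A vector in the left kernel takes equal values at both ends of every edge, so connectedness
    makes it constant: the kernel has dimension at most 1. *)
Lemma rank_edge_incidence s :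
    (forall x y, connect (fun d e => (e == s d) || (e == a d)) x y) ->
  (#|porbits s| <= (\rank (incidence s *m (incidence a)^T)).+1)%N.
Proof.
move=> conn; set M := _ *m _.
suff : (\rank (kermx M) <= 1)%N by rewrite mxrank_ker; lia.
suff sub : (kermx M <= (const_mx 1 : 'rV_#|porbits s|))%MS.
  by apply: leq_trans (mxrankS sub) (rank_leq_row _).
apply/row_subP => i; set u := row i _.
have uM : u *m M = 0 by apply/sub_kermxP; apply: row_sub.
have uA d : u 0 (orbit_index s (a d)) = u 0 (orbit_index s d).
  have /eqP := mul_edge_incidence u d; rewrite uM mxE eq_sym addr_eq0 => /eqP ->.
  by apply/eqP; rewrite -addr_eq0 addF2.
have uconst d e : u 0 (orbit_index s e) = u 0 (orbit_index s d).
  have /connectP[p pth ->] := conn d e; elim: p d pth => //= b p IH d /andP[db pth].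
  rewrite IH //; case/orP: db => /eqP->; last exact: uA.
  by congr (u 0 _); apply/eqP; rewrite orbit_index_eq porbit_sym porbit_step.
have [d0 _] := orbit_indexP i; apply/sub_rVP; exists (u 0 (orbit_index s d0)).
apply/rowP => j; have [d ->] := orbit_indexP j.
by rewrite [RHS]mxE [X in _ * X]mxE mulr1 (uconst d0).
Qed.

(** Each dart of a face ends at the vertex where the next one starts. So the sums over starting
    points and over end points agree after reindexing by the face permutation, and cancel mod 2. *)
Lemma edge_incidence_orthogonal s :
  (incidence s *m (incidence a)^T) *m
  (incidence (a * s^-1)%g *m (incidence a)^T)^T = 0.
Proof.
apply/row_matrixP => i; rewrite row0 row_mul; apply/rowP => j; rewrite [RHS]mxE.
have [d ->] := orbit_indexP j; rewrite trmx_mul trmxK mulmxA mul_incidence_tr.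
set w := row i _.
have wE e : (w *m incidence a) 0 e = (i == orbit_index s e)%:R + (i == orbit_index s (a e))%:R.
  rewrite mul_incidence /w row_mul mul_incidence_tr sum_edge.
  by rewrite !mxE.
under eq_bigr => e _ do rewrite wE.
rewrite big_split /= [X in _ + X](_ : _ =
  \sum_(e in porbit (a * s^-1)%g d) (i == orbit_index s e)%:R).
  exact: addF2.
rewrite [RHS](reindex_inj (@perm_inj _ (a * s^-1)%g)) /=.
apply: eq_big => [e|e _].
  by rewrite -!eq_porbit_mem -(porbit_perm _ 1 e) expg1.
rewrite permM; congr ((i == _)%:R); apply/eqP; rewrite orbit_index_eq.
by rewrite -porbitV porbit_step.
Qed.

End Incidence.

(* In the mod-2 cellular chain complex of a planar map the coboundaries have the
   same dimension V - 1 as the cocycles, by Euler's formula; the all-ones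
   cochain is a cocycle when all faces are even. *)
Lemma planar_even_bipartite k (A : rpmap k) :
    is_map A -> (forall d, ~~ odd #|porbit (fphi A) d|) ->
  exists c : 'I_k -> bool,
    (forall d, c (sg A d) = c d) /\ (forall d, c (al A d) = ~~ c d).
Proof.
move=> /andP[/andP[/forallP aKN /forallP conn] /eqP euler] even.
have aK d : al A (al A d) = d by have /andP[/eqP] := aKN d.
have aN d : al A d != d by have /andP[] := aKN d.
have connV x y : linked A x y by have /forallP := conn x; apply.
have connF x y : connect (fun d e => (e == fphi A d) || (e == al A d)) x y.
  have step b c : (c == sg A b) || (c == al A b) ->
      connect (fun d e => (e == fphi A d) || (e == al A d)) c b.
    case/orP=> /eqP->; last by apply: connect1; rewrite aK eqxx orbT.
    apply: (@connect_trans _ _ (al A (sg A b))); apply: connect1; rewrite ?eqxx ?orbT //.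
    by rewrite permM aK permK eqxx.
  have /connectP[p pth ->] := connV y x; elim: p y pth => [|b p IH] y /=; first by [].
  by case/andP=> /step yb /IH; move/connect_trans; apply.
have rV := rank_edge_incidence aK aN connV.
have rF := rank_edge_incidence aK aN connF.
have orth := edge_incidence_orthogonal aK aN (sg A).
set BV := (X in \rank X) in rV; set BF := (X in \rank X) in rF.
rewrite -/(fphi A) -/BV -/BF in orth.
have cardE : #|porbits (al A)| * 2 = k.
  by rewrite (card_porbits_uniform (n := 2)) ?card_ord // => d; apply: card_porbit2.
have sub : (BV <= kermx BF^T)%MS by apply/sub_kermxP.
(* The kernel has dimension E - rank BF, at most E - F + 1, which is V - 1 by Euler's formula, and
   [rV] bounds V - 1 by rank BV. *)
have rk : \rank (kermx BF^T) <= \rank BV.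
  rewrite mxrank_ker mxrank_tr; move: euler; rewrite /nvertices /nfaces; lia.
have eqm : (kermx BF^T <= BV)%MS by rewrite (geq_leqif (mxrank_leqif_sup sub)) in rk.
have one : ((const_mx 1%R : 'rV_#|porbits (al A)|) <= kermx BF^T)%MS.
  apply/sub_kermxP/rowP => j; have [d ->] := orbit_indexP j.
  rewrite trmx_mul trmxK mulmxA mul_incidence_tr mxE.
  under eq_bigr => e _ do rewrite mul_incidence mxE.
  rewrite GRing.sumr_const -(odd_double_half #|_|) (negbTE (even d)) add0n -mul2n.
  by rewrite GRing.mulrnA (_ : (1 *+ 2)%R = 0%R :> 'F_2) ?GRing.mul0rn //; apply/eqP.
have /submxP[u uB] := submx_trans one eqm.
(* A potential whose coboundary is 1 on every edge separates the two ends of each edge. *)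
exists (fun d => u 0%R (orbit_index (sg A) d) == 1%R); split=> d.
  congr (u 0%R _ == 1%R); apply/eqP; rewrite orbit_index_eq porbit_sym.
  exact: porbit_step.
have := mul_edge_incidence aK aN u d; rewrite -/BV -uB mxE.
by move: (u 0%R _) (u 0%R _) => [[|[|x]] hx] // [[|[|y]] hy].
Qed.

(** * Labelled quadrangulations and their Schaeffer maps *)

Section LabelledQuad.
Variables (T : finType) (s a : {perm T}) (L : T -> nat).

Definition rising d := L d < L (a d).
Local Notation up := rising.

(* Schaeffer's new edges, read on the increasing darts: the dart [d] stands for
   the corner of [s^-1 d]. *)
Definition new_edge d :=
  if ~~ up ((s^-1)%g d) then a ((s^-1)%g d)
  else if up (s (a d)) then s (a d) else s (a (s (a d))).

Record labelled_quad : Prop := LabelledQuad {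
  lq_inv : forall d, a (a d) = d;
  lq_vertex : forall d, L (s d) = L d;
  lq_edge : forall d, (L (a d) == (L d).+1) || (L d == (L (a d)).+1);
  lq_face : forall d, #|porbit (a * s^-1)%g d| = 4 }.

Hypothesis lq : labelled_quad.
Let aK := lq_inv lq.
Let Ls := lq_vertex lq.

Lemma up_label d : up d -> L (a d) = (L d).+1.
Proof. by rewrite /up; have := lq_edge lq d; lia. Qed.

Lemma down_label d : ~~ up d -> L d = (L (a d)).+1.
Proof. by rewrite /up; have := lq_edge lq d; lia. Qed.

Lemma up_edge d : up (a d) = ~~ up d.
Proof. by rewrite /up aK; have := lq_edge lq d; lia. Qed.

Lemma vertex_labelV d : L ((s^-1)%g d) = L d.
Proof. by rewrite -{2}(permKV s d) Ls. Qed.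

Lemma face4 d : s (a (s (a (s (a (s (a d))))))) = d.
Proof.
have sface x : s ((a * s^-1)%g x) = a x by rewrite permM permKV.
have /eqP/card_porbit4P[f4 _] := lq_face lq (a d).
by rewrite -{1}f4 sface aK sface aK sface aK sface aK.
Qed.

Lemma face2 d : s (a (s (a d))) <> d.
Proof.
move=> d2; have /eqP/card_porbit4P[_] := lq_face lq (a d); apply.
by rewrite !permM aK -{1}d2 permK aK permK.
Qed.

(** A corner between a decreasing and an increasing dart has one closer and one farther neighbour,
    so its face is simple; [p] marks the corner of that face closest to the origin. *)
Lemma prev_down c : ~~ up c -> up (s c) ->
  exists p, [/\ up p, s p = a c, a p = s (a (s (a (s c)))) & ~~ up (s (a (s c)))].
Proof.
move=> dc usc; exists ((s^-1)%g (a c)).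
have sp := permKV s (a c).
have ap : a ((s^-1)%g (a c)) = s (a (s (a (s c)))).
  apply: (@perm_inj _ a); apply: (@perm_inj _ s); rewrite aK sp.
  by have := face4 (a c); rewrite aK.
have := lq_edge lq ((s^-1)%g (a c)); have := lq_edge lq (s (a (s c))).
have := down_label dc; have := up_label usc; rewrite /up ap !Ls vertex_labelV.
by move=> *; split=> //; lia.
Qed.

Lemma new_edge_down c : ~~ up c -> new_edge (s c) = a c.
Proof. by rewrite /new_edge permK => ->. Qed.

Lemma new_edge_up c : up c -> up (s (a (s c))) -> new_edge (s c) = s (a (s c)).
Proof. by rewrite /new_edge permK => -> ->. Qed.

Lemma new_edge_flat c : up c -> ~~ up (s (a (s c))) ->
  new_edge (s c) = s (a (s (a (s c)))).
Proof. by rewrite /new_edge permK => -> /negbTE ->. Qed.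

Lemma face_back c : s (a (s (a (s (a (s c)))))) = a c.
Proof. by apply: (@perm_inj _ a); apply: (@perm_inj _ s); rewrite aK face4. Qed.

Lemma flat_up c : up c -> up (s c) -> ~~ up (s (a (s c))) ->
  up (s (a (s (a (s c))))) /\ ~~ up (a c).
Proof.
move=> uc usc ds; have Ly : L (a (s (a (s (a (s c)))))) = L (a c).
  by rewrite -[in RHS]face_back Ls.
have := up_label uc; have := down_label ds; have := up_label usc.
by rewrite up_edge uc /up Ly !Ls => *; split=> //; lia.
Qed.

(** The three kinds of new edge: the far end of a simple-face edge, where the label drops; its near
    end, where the label rises; and a diagonal of a confluent face, where the label is constant. *)
Lemma new_edge_spec c : up (s c) ->
  [\/ [/\ ~~ up c, new_edge (s c) = a c, (L (a c)).+1 = L (s c),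
           up ((s^-1)%g (a c)) & ~~ up (s (a (s c)))],
      [/\ up c, up (s (a (s c))), new_edge (s c) = s (a (s c))
         & L (s (a (s c))) = (L (s c)).+1]
    | [/\ up c, ~~ up (s (a (s c))), new_edge (s c) = s (a (s (a (s c)))),
           L (s (a (s (a (s c))))) = L (s c) & up (a (s (a (s c))))]].
Proof.
move=> usc; have [uc|dc] := boolP (up c); last first.
  constructor 1; have [p [up_p sp _ ds]] := prev_down dc usc.
  by rewrite new_edge_down // Ls (down_label dc) -sp permK.
have [us|ds] := boolP (up (s (a (s c)))).
  by constructor 2; rewrite new_edge_up // Ls (up_label usc).
constructor 3; rewrite new_edge_flat // up_edge; split=> //.
by have := down_label ds; rewrite !Ls; have := up_label usc; rewrite Ls => ->; case.
Qed.

Lemma new_edge_next d : up d -> up (s (a d)) -> new_edge d = s (a d).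
Proof.
rewrite -(permKV s d); move: ((s^-1)%g d) => c usc us.
by case: (new_edge_spec usc) => [[_ _ _ _]|[_ _ ->]|[_]]; rewrite ?us.
Qed.

Lemma new_edge_in d : up d -> up (new_edge d).
Proof.
rewrite -(permKV s d); move: ((s^-1)%g d) => c usc.
case: (new_edge_spec usc) => [[dc -> _ _ _]|[_ us -> _]|[uc ds -> _ _]] //.
  by rewrite up_edge.
by have [] := flat_up uc usc ds.
Qed.

Lemma new_edgeK d : up d -> new_edge (new_edge d) = d.
Proof.
rewrite -(permKV s d); move: ((s^-1)%g d) => c usc.
case: (new_edge_spec usc) => [[dc -> _ up_p _]|[uc us -> _]|[uc ds -> _ u']].
- by rewrite -(permKV s (a c)) new_edge_up // permKV aK.
- by rewrite new_edge_down ?aK // up_edge usc.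
- by have [_ dac] := flat_up uc usc ds; rewrite new_edge_flat // face_back // aK.
Qed.

Lemma new_edge_neq d : up d -> new_edge d <> d.
Proof.
rewrite -(permKV s d); move: ((s^-1)%g d) => c usc.
case: (new_edge_spec usc) => [[_ -> + _ _]|[_ _ -> +]|[_ _ -> _ _]].
- by move=> Lc ac; rewrite -ac in Lc; lia.
- by move=> Lc ac; rewrite ac in Lc; lia.
- exact: face2.
Qed.

Lemma new_edge_label d : up d -> L (new_edge d) <= (L d).+1.
Proof.
rewrite -(permKV s d); move: ((s^-1)%g d) => c usc.
by case: (new_edge_spec usc) => [[_ -> <- _ _]|[_ _ -> ->]|[_ _ -> -> _]] //; lia.
Qed.

End LabelledQuad.

(** * Vertices and faces of the Schaeffer map *)

Section SchaefferMap.
Variables (T U : finType) (s a : {perm T}) (L : T -> nat).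
Variables (sM aM : {perm U}) (g : U -> T).

Local Notation up := (rising a L).

(* [sM], [aM] are the rotation and the edge involution of the map obtained by
   Schaeffer's rule; a dart of it is identified by [g] with the increasing dart
   following its end-corner. *)
Record schaeffer_map : Prop := SchaefferMap {
  sch_inj : injective g;
  sch_up : forall u, up (g u);
  sch_onto : forall d, up d -> exists u, g u = d;
  sch_rot : forall u, fret s up (g u) (g (sM u));
  sch_edge : forall u, g (aM u) = new_edge s a L (g u) }.

Hypotheses (lq : labelled_quad s a L) (sch : schaeffer_map).
Let aK := lq_inv lq.
Let Ls := lq_vertex lq.
Let g_up := sch_up sch.
Let Lorb := porbit_const Ls.

Local Notation phiM := (aM * sM^-1)%g.

Lemma sch_rotV u : fret (s^-1)%g up (g u) (g ((sM^-1)%g u)).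
Proof. by have := fret_inv (sch_rot sch ((sM^-1)%g u)) (g_up _); rewrite permKV. Qed.

Lemma sch_face u : fret (s^-1)%g up (new_edge s a L (g u)) (g (phiM u)).
Proof. by rewrite -(sch_edge sch) permM; apply: sch_rotV. Qed.

Lemma sch_face_label u : L (g (phiM u)) = L (new_edge s a L (g u)).
Proof. by have := fret_porbit (sch_face u); rewrite porbitV; apply: Lorb. Qed.

Lemma sch_face_eq u v : fret (s^-1)%g up (new_edge s a L (g u)) (g v) -> phiM u = v.
Proof. by move=> /fret_fun/(_ (sch_face u))/(sch_inj sch). Qed.

Lemma fret_hitV d : up d -> fret (s^-1)%g up (s d) d.
Proof. by move=> ud; rewrite -{2}(permK s d); apply: FretHit; rewrite permK. Qed.

(* Turning around a vertex of label [t.+1] of Q, [down_step t] gives [up_step t];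
   crossing a simple face of Q, [up_step t] gives [down_step t.+1]. *)
Definition down_step t := forall u u', L (g u) = t -> s (a (g u)) = a (g u') ->
  fret phiM (fun v => t <= L (g v)) u u'.

Definition up_step t := forall u x, L (g u) = t -> fret (s^-1)%g up (a (g u)) (g x) ->
  fret phiM (fun v => t < L (g v)) u x.

Lemma down_edge_label u u' : s (a (g u)) = a (g u') -> L (g u') = L (g u).
Proof.
move=> /(congr1 L); rewrite Ls (up_label lq (g_up u)) (up_label lq (g_up u')).
by case.
Qed.

Lemma down_edge d : ~~ up d -> exists u, d = a (g u).
Proof.
rewrite -(up_edge lq) => /(sch_onto sch)[u ud]; exists u.
by rewrite ud aK.
Qed.

(** Induction along the run of decreasing darts counterclockwise from [a (g u)]: they all share the
    clockwise exit [x]. The last one belongs to a simple face whose new edge leads straight to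
    [x]. *)
Lemma up_step_from_down t : down_step t -> up_step t.
Proof.
move=> R u x Lu ux.
have [z uz] : exists z, fret s up (a (g u)) z.
  have := fret_porbit ux; rewrite porbitV porbit_sym => gxu.
  by apply: fret_exists (g_up x); rewrite porbit_sym.
move eqd: (a (g u)) uz ux => d uz.
elim: uz u eqd Lu => {d z} [d ud|d z nud _ IH] u eqd Lu ux.
all: have sx : fret (s^-1)%g up (s d) (g x)
  by apply: FretSkip; rewrite permK -?eqd ?(up_edge lq) ?g_up // eqd.
  have := new_edge_next lq (g_up u); rewrite eqd => /(_ ud) ne.
  have <- : phiM u = x by apply: sch_face_eq; rewrite ne.
  by apply: FretHit; rewrite sch_face_label ne Ls -eqd (up_label lq) // Lu.
have [u' du'] := down_edge nud.
have uu' : s (a (g u)) = a (g u') by rewrite eqd.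
have Lu' : L (g u') = t by rewrite (down_edge_label uu').
apply: (fret_sub (P := fun v => t <= L (g v))); first by move=> v; apply: ltnW.
- exact: (R _ _ Lu uu').
- by rewrite Lu' ltnn.
- by apply: (IH _ _ Lu'); rewrite -?du'.
Qed.

(** If the face of Q to be crossed is confluent, its diagonal leads to [u'] at once. If it is
    simple, the new edge drops to [q] at label [t - 1], and the increasing dart [q] ends at the
    corner of [u']. Being above [t - 1] is the same as being at least [t]. *)
Lemma down_step_from_up t : (forall t', t = t'.+1 -> up_step t') -> down_step t.
Proof.
move=> S u u' Lu uu'.
have Lu' : L (g u') = t by rewrite (down_edge_label uu').
have ds : ~~ up (s (a (g u))) by rewrite uu' (up_edge lq) g_up.
have := new_edge_spec lq (c := (s^-1)%g (g u)); rewrite permKV => /(_ (g_up u)).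
case=> [[dc ne Lac up_p _]|[_ us]|[uc _ ne _ uu]]; last 2 first.
- by rewrite us in ds.
- have pu : phiM u = u' by apply: sch_face_eq; rewrite ne uu' aK; apply: fret_hitV.
  by rewrite -pu; apply: FretHit; rewrite pu Lu'.
move: dc ne Lac; set c := (s^-1)%g (g u) => dc ne Lac.
have sc : s c = g u := permKV s (g u); have usc : up (s c) by rewrite sc.
have [q [uq sq aq _]] := prev_down lq dc usc.
have gp : g (phiM u) = q.
  by apply: fret_fun (sch_face u) _; rewrite ne -sq; apply: fret_hitV.
have Lq : (L q).+1 = t by rewrite -(Ls q) sq; move: Lac; rewrite ?sc Lu.
apply: FretSkip; first by rewrite gp -Lq ltnn.
rewrite -Lq; apply: (S _ (esym Lq)); rewrite gp // aq sc uu' aK.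
exact: fret_hitV.
Qed.

Lemma down_up_step t : down_step t /\ up_step t.
Proof.
elim: t => [|t [_ IH]].
  have D : down_step 0 by apply: down_step_from_up.
  by split=> //; apply: up_step_from_down.
have D : down_step t.+1 by apply: down_step_from_up => _ [<-].
by split=> //; apply: up_step_from_down.
Qed.

Lemma face_next_down u u' : s (a (g u)) = a (g u') ->
  fret phiM (fun v => L (g u) <= L (g v)) u u'.
Proof. by have [D _] := down_up_step (L (g u)); apply: D. Qed.

Lemma face_next_up u x : fret (s^-1)%g up (a (g u)) (g x) ->
  fret phiM (fun v => L (g u) < L (g v)) u x.
Proof. by have [_ S] := down_up_step (L (g u)); apply: S. Qed.

(** A local maximum has no increasing dart, hence no corner in M, so it is represented by the
    increasing darts that end at it. *)
Definition sink u := [forall d in porbit s (a (g u)), ~~ up d].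

Lemma sink_face u v : sink u -> a (g v) \in porbit s (a (g u)) ->
  [/\ sink v, v \in porbit phiM u & L (g v) = L (g u)].
Proof.
move=> su uv; split.
- apply/forall_inP => d vd; move/forall_inP: su; apply; exact: porbit_trans uv vd.
- pose K d := d \in porbit s (a (g u)) /\ exists2 w, d = a (g w) & w \in porbit phiM u.
  suff [_ [w /(@perm_inj _ a)/(sch_inj sch) <-]] : K (a (g v)) by [].
  apply: (porbit_ind (K := K) _ _ uv) => [x [uw [w xw wu]]|]; last first.
    by split; [exact: porbit_id | exists u => //; exact: porbit_id].
  have us := porbit_trans uw (porbit_step _ _); split=> //.
  have [w' sw] := down_edge (forall_inP su _ us); exists w' => //.
  by apply: porbit_trans wu (fret_porbit (face_next_down _)); rewrite -xw.
- apply/succn_inj; rewrite -!(up_label lq) //; exact: Lorb.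
Qed.

(** Starting from the sink of smaller label, successive returns to labels at least [L (g u)] only
    turn around its local maximum. They visit every such corner of the face, hence also [v]. *)
Lemma sink_face_inj u v : sink u -> sink v -> v \in porbit phiM u ->
  a (g v) \in porbit s (a (g u)).
Proof.
wlog Luv : u v / L (g u) <= L (g v).
  move=> wl su sv uv; case: (leqP (L (g u)) (L (g v))) => [|/ltnW] Luv; first exact: wl.
  by rewrite porbit_sym wl // porbit_sym.
move=> su _ uv; pose K w := a (g w) \in porbit s (a (g u)).
apply: (fret_closed (P := fun w => L (g u) <= L (g w)) (K := K) _ _ uv) => // [w Kw|].
  have us := porbit_trans Kw (porbit_step _ _).
  have [w' sw] := down_edge (forall_inP su _ us).
  exists w'; first by rewrite /K -sw.
  by have [_ _ <-] := sink_face su Kw; apply: face_next_down.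
exact: porbit_id.
Qed.

(** An increasing dart that does not end at a local maximum leads to a corner of the same face with
    a larger label; labels are bounded, so the climb stops. *)
Lemma face_sink u : exists2 v, sink v & v \in porbit phiM u.
Proof.
pose B := \max_v L (g v); have LB v : L (g v) <= B by apply: (leq_bigmax (F := L \o g)).
have [n] := ubnP (B - L (g u)); elim: n u => // n IH u Bn.
have [su|nsu] := boolP (sink u); first by exists u => //; apply: porbit_id.
move: nsu; rewrite negb_forall_in => /exists_inP[d ud]; rewrite negbK => upd.
have [z uz] : exists z, fret (s^-1)%g up (a (g u)) z.
  by apply: (fret_exists _ upd); rewrite porbitV.
have [x xz] := sch_onto sch (fret_in uz); rewrite -xz in uz.
have ux := face_next_up uz.
have [|v sv xv] := IH x; first by have := fret_in ux; have := LB x; lia.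
by exists v => //; apply: porbit_trans (fret_porbit ux) xv.
Qed.

Lemma schaeffer_faces :
  #|porbits phiM| = #|[set O in porbits s | [forall d in O, ~~ up d]]|.
Proof.
have -> : [set O in porbits s | [forall d in O, ~~ up d]]
        = [set porbit s (a (g u)) | u in [set u | sink u]].
  apply/setP=> O; rewrite inE; apply/andP/imsetP => [[/imsetP[d _ ->] dO]|[u]].
    have [u du] := down_edge (forall_inP dO _ (porbit_id s d)).
    by exists u; rewrite -?du // inE /sink -du.
  by rewrite inE => su ->; rewrite imset_f.
have -> : porbits phiM = porbit phiM @: [set u | sink u].
  apply/setP=> O; apply/imsetP/imsetP => [[u _ ->]|[u _ ->]]; last by exists u.
  have [v sv uv] := face_sink u; exists v; rewrite ?inE //.
  by apply/esym/eqP; rewrite eq_porbit_mem.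
apply: card_imset_eq => u v; rewrite !inE => su sv; rewrite !eq_porbit_mem.
by apply/idP/idP => [|/(sink_face sv)[]] //; apply: sink_face_inj.
Qed.

Lemma sch_vertex u v : (g v \in porbit s (g u)) = (v \in porbit sM u).
Proof.
apply/idP/idP => uv.
  pose K d := exists2 w, d = g w & w \in porbit sM u.
  suff [w /(sch_inj sch) <-] : K (g v) by [].
  apply: (fret_closed (P := up) (K := K) _ _ uv) => // [x [w -> uw]|].
    exists (g (sM w)); last exact: sch_rot.
    by exists (sM w) => //; apply: porbit_trans uw (porbit_step _ _).
  by exists u => //; apply: porbit_id.
apply: (porbit_ind (K := fun w => g w \in porbit s (g u)) _ _ uv) => [w uw|]; last exact: porbit_id.
exact: porbit_trans uw (fret_porbit (sch_rot sch w)).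
Qed.

Lemma schaeffer_vertices :
  #|porbits s| = #|porbits sM| + #|[set O in porbits s | [forall d in O, ~~ up d]]|.
Proof.
rewrite -(cardsID [set O : {set T} | [forall d in O, ~~ up d]] (porbits s)) addnC.
congr (_ + _); last first.
  by apply: eq_card => O; rewrite !inE.
have -> : porbits s :\: [set O : {set T} | [forall d in O, ~~ up d]] = (porbit s \o g) @: setT.
  apply/setP=> O; rewrite !inE; apply/andP/imsetP => [[+ /imsetP[d _ Od]]|[u _ ->]].
    rewrite {}Od negb_forall_in => /exists_inP[e de]; rewrite negbK => /(sch_onto sch)[u ue].
    by exists u => //=; apply/esym/eqP; rewrite eq_porbit_mem ue.
  split=> /=; last exact: imset_f.
  rewrite negb_forall_in; apply/exists_inP; exists (g u); rewrite ?negbK //.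
  exact: porbit_id.
have -> : porbits sM = porbit sM @: setT.
  by apply/setP=> O; apply/imsetP/imsetP => [] [u _ ->]; exists u.
by apply: card_imset_eq => u v _ _; rewrite /= !eq_porbit_mem sch_vertex.
Qed.

(** From here to the end of the section, the rotation of Q is expressed through M and the labels
    alone. This is the input of the uniqueness proof. *)
Lemma rot_down_up u : up (s (a (g u))) = (L (g (aM u)) == (L (g u)).+1).
Proof.
have := new_edge_spec lq (c := (s^-1)%g (g u)); rewrite permKV => /(_ (g_up u)).
rewrite (sch_edge sch).
case=> [[_ -> Lc _ /negbTE->]|[_ -> -> ->]|[_ /negbTE-> -> -> _]]; last 1 first.
- by rewrite ltn_eqF.
- by apply/esym/eqP => e; move: Lc; rewrite e; lia.
- by rewrite eqxx.
Qed.

Lemma rot_down_eq u : up (s (a (g u))) -> s (a (g u)) = g (aM u).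
Proof. by move=> us; rewrite (sch_edge sch) new_edge_next. Qed.

Lemma rotV_up u : up ((s^-1)%g (g u)) = ((L (g (aM u))).+1 != L (g u)).
Proof.
have := new_edge_spec lq (c := (s^-1)%g (g u)); rewrite permKV => /(_ (g_up u)).
rewrite (sch_edge sch).
case=> [[/negbTE-> -> -> _ _]|[-> _ -> ->]|[-> _ -> -> _]]; rewrite ?eqxx //.
  by lia.
by rewrite gtn_eqF.
Qed.

Lemma rot_up_eq w y : s (g w) = g y -> sM w = y.
Proof.
move=> wy; apply: (sch_inj sch); apply: fret_fun (sch_rot sch w) _.
by rewrite -wy; apply: FretHit; rewrite wy.
Qed.

Lemma rot_up_down w v : s (g w) = a (g v) ->
  fret phiM (fun u => L (g v) < L (g u)) v w.
Proof. by move=> wv; apply: face_next_up; rewrite -wv; apply: fret_hitV. Qed.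

End SchaefferMap.

(** * Schaeffer maps of rooted pointed quadrangulations *)

Lemma find_fret (T : finType) (s : {perm T}) (P : pred T) n x y :
    #|T| <= n -> P x -> fret s P x y ->
  (s ^+ (find (fun j => P ((s ^+ j.+1)%g x)) (iota 0 n)).+1)%g x = y.
Proof.
move=> Tn Px /fretP[m [-> Py Pm]]; congr ((s ^+ _.+1)%g x); apply: find_iota => //.
apply: leq_trans (leq_trans _ (max_card (mem (porbit s x)))) Tn.
(* A first return later than the orbit length would have passed through [x], where [P] holds. *)
rewrite ltnNge; apply/negP => om; have := card_porbit_neq0 s x; rewrite -lt0n => o_gt0.
have := Pm #|porbit s x|.-1; rewrite prednK // => /(_ om).
by rewrite permX iter_porbit Px.
Qed.

Definition dist_quad k (Q : rpmap k) : Prop :=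
  labelled_quad (sg Q) (al Q) (dist Q) /\ geodesic Q (dist Q).

Definition schaeffer_rpmap k m (Q : rpmap k) (M : rpmap m) (g : 'I_m -> 'I_k) : Prop :=
  [/\ schaeffer_map (sg Q) (al Q) (dist Q) (sg M) (al M) g,
      g (rt M) = rootLow Q & g (og M) \in porbit (sg Q) (og Q)].

Section Corners.
Variables (k : nat) (Q : rpmap k).
Hypothesis lq : labelled_quad (sg Q) (al Q) (dist Q).
Let aK := lq_inv lq.
Let Ls := lq_vertex lq.

Local Notation s := (sg Q).
Local Notation a := (al Q).
Local Notation L := (dist Q).
Local Notation up := (rising a L).

Lemma fphiE c : fphi Q c = (s^-1)%g (a c).
Proof. by rewrite permM. Qed.

Lemma fphiVE c : ((fphi Q)^-1)%g c = a (s c).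
Proof. by apply: (@perm_inj _ (fphi Q)); rewrite permKV fphiE aK permK. Qed.

Lemma fphi2E c : fphi Q (fphi Q c) = a (s (a (s c))).
Proof.
rewrite -!fphiVE; apply: (@perm_inj _ (fphi Q)); rewrite permKV.
apply: (@perm_inj _ (fphi Q)); rewrite permKV.
by have /eqP/card_porbit4P[] := lq_face lq c.
Qed.

Lemma isMinE c : isMin Q c = up c && up (s c).
Proof.
rewrite /isMin fphiVE fphiE /rising Ls; congr (_ && _).
by rewrite -(Ls ((s^-1)%g _)) permKV.
Qed.

Lemma fphi3E c : fphi Q (fphi Q (fphi Q c)) = a (s c).
Proof.
rewrite -fphiVE; apply: (@perm_inj _ (fphi Q)); rewrite permKV.
by have /eqP/card_porbit4P[] := lq_face lq c.
Qed.

Lemma endcE c : endc Q c = up (s c).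
Proof.
rewrite /endc fphi3E !isMinE !(up_edge lq).
have sf x : s (fphi Q x) = a x by rewrite fphiE permKV.
rewrite !sf; have [uc|dc] := boolP (up c); have [us|ds] := boolP (up (s c)) => //=.
- by rewrite (up_edge lq) uc andbF.
- have [p [up_p sp _ _]] := prev_down lq dc us.
  have -> : fphi Q c = p by rewrite fphiE -sp permK.
  by rewrite up_p (up_edge lq) dc.
have LV x : L (fphi Q x) = L (a x) by rewrite -sf Ls.
have := down_label lq dc; have := down_label lq ds.
by rewrite /rising -fphi2E !Ls !LV => *; lia.
Qed.

Lemma partnerE c : up (s c) -> s (partner Q c) = new_edge s a L (s c).
Proof.
move=> us; rewrite /partner !isMinE fphi2E fphiVE fphiE us andbT /new_edge permK.
have [uc|dc] := boolP (up c); last by rewrite permKV.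
rewrite (up_edge lq) /=; have [//|ds] := boolP (up (s (a (s c)))).
by have [-> _] := flat_up lq uc us ds.
Qed.

Lemma nextE_fret c : endc Q c -> fret s (endc Q) c (Defs.nextE Q c).
Proof.
move=> ec; have [z cz] := fret_exists (porbit_id s c) ec.
by rewrite /Defs.nextE (find_fret _ ec cz) // card_ord.
Qed.

Lemma up_rootLow : up (rootLow Q).
Proof. by rewrite /rootLow; case: ifPn => // dr; rewrite (up_edge lq). Qed.

Lemma rootPhiE : s (rootPhi Q) = rootLow Q.
Proof.
(* The search stops at index 0, since the corner just before an increasing dart is always an
   end-corner. *)
rewrite /rootPhi /Defs.prevE; cbv zeta; rewrite (find_iota (m := 0)) ?expg1 ?permKV //.
  by case: (rootLow Q) => i; case: (k).
by rewrite endcE permKV up_rootLow.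
Qed.

Lemma PhiRel_schaeffer m (M : rpmap m) :
  PhiRel Q M <-> exists g, schaeffer_rpmap Q M g.
Proof.
split=> [[f [injf onto fe fs [fa fr fo]]]|[g [[injg gup onto gs ga] gr go]]].
  exists (fun u => s (f u)); split; first split.
  - by move=> u v /perm_inj/injf.
  - by move=> u; rewrite -endcE.
  - move=> d ud; have [|u fu] := onto ((s^-1)%g d); first by rewrite endcE permKV.
    by exists u; rewrite fu permKV.
  - move=> u; rewrite fs; apply: fret_morph (nextE_fret (fe u)) => // x.
    by rewrite endcE.
  - by move=> u; rewrite fa partnerE // -endcE.
  - by rewrite fr rootPhiE.
  - exact: porbit_trans fo (porbit_step _ _).
exists (fun u => (s^-1)%g (g u)); split.
- by move=> u v /perm_inj/injg.
- by move=> c; rewrite endcE => /onto[u gu]; exists u; rewrite gu permK.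
- by move=> u; rewrite endcE permKV.
- move=> u; have e : endc Q ((s^-1)%g (g u)) by rewrite endcE permKV.
  apply: (@perm_inj _ s); rewrite permKV.
  have gn : fret s up (g u) (s (Defs.nextE Q ((s^-1)%g (g u)))).
    by rewrite -{1}(permKV s (g u)); apply: fret_morph (nextE_fret e) => // x; rewrite endcE.
  exact: fret_fun (gs u) gn.
split.
- by move=> u; apply: (@perm_inj _ s); rewrite permKV partnerE ?permKV.
- by rewrite gr -rootPhiE permK.
- by apply: porbit_trans go _; rewrite -porbitV porbit_step.
Qed.

End Corners.

(** * Distances in the Schaeffer map *)

Section Geodesic.
Variables (k m : nat) (Q : rpmap k) (M : rpmap m) (g : 'I_m -> 'I_k).
Hypotheses (dq : dist_quad Q) (schQ : schaeffer_rpmap Q M g).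
Let lq : labelled_quad (sg Q) (al Q) (dist Q) := proj1 dq.

Lemma schaeffer_inv u : al M (al M u) = u.
Proof.
have [sch _ _] := schQ; apply: (sch_inj sch).
by rewrite !(sch_edge sch) (new_edgeK lq) // (sch_up sch).
Qed.

Lemma schaeffer_fix u : al M u <> u.
Proof.
have [sch _ _] := schQ; move/(congr1 g); rewrite (sch_edge sch).
by apply: (new_edge_neq lq); apply: (sch_up sch u).
Qed.

(** For the descent condition, turn counterclockwise from a decreasing dart to the first increasing
    one. The corner between them lies in a simple face, and its new edge lowers the label by one. *)
Lemma schaeffer_geodesic : geodesic M (fun u => dist Q (g u)).
Proof.
have [sch _ go] := schQ; have [_ [Ls La L0 Ldown]] := dq.
have Lorb := porbit_const Ls; split.
- by move=> u; apply: Lorb; apply: fret_porbit (sch_rot sch u).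
- by move=> u; rewrite (sch_edge sch); apply: new_edge_label => //; apply: sch_up sch u.
- move=> u; rewrite L0 -(sch_vertex sch) -!eq_porbit_mem.
  by rewrite -eq_porbit_mem in go; rewrite (eqP go).
move=> u /Ldown[e ue Le].
have de : ~~ rising (al Q) (dist Q) e by rewrite /rising -leqNgt (Lorb _ _ ue) ltnW.
have eu : g u \in porbit (sg Q) e by rewrite porbit_sym.
have [z [ez dz]] := fret_before de eu (sch_up sch u).
have [v gv] := sch_onto sch (fret_in ez); exists v.
  by rewrite -(sch_vertex sch) gv (porbit_trans ue (fret_porbit ez)).
have uz : rising (al Q) (dist Q) (sg Q (((sg Q)^-1)%g z)) by rewrite permKV; apply: fret_in ez.
have := new_edge_spec lq uz; rewrite permKV => -[[_ ne Lz _ _]|[uz' _ _]|[uz' _ _]].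
- by rewrite (sch_edge sch) gv ne -(Lorb _ _ (porbit_trans ue (fret_porbit ez))) -ltnS Lz.
- by rewrite uz' in dz.
- by rewrite uz' in dz.
Qed.

Lemma schaeffer_dist u : dist M u = dist Q (g u).
Proof. exact: geodesic_dist schaeffer_inv _ schaeffer_geodesic u. Qed.

End Geodesic.

(** Descending to the origin shows that the parity of the distance is the 2-colouring of Q, up to
    its value at the origin. Adjacent labels thus differ, and the Lipschitz bound makes the
    difference one. *)
Lemma is_quad_dist_quad k (Q : rpmap k) : is_quad Q -> dist_quad Q.
Proof.
case/andP=> mapQ /forallP face4; have := mapQ.
case/andP=> /andP[/forallP aKN /forallP conn] _.
have aK d : al Q (al Q d) = d by have /andP[/eqP] := aKN d.
have geo : geodesic Q (dist Q).
  by apply: dist_geodesic => // x y; have /forallP := conn x; apply.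
have [|c [cs ca]] := planar_even_bipartite mapQ; first by move=> d; rewrite (eqP (face4 d)).
split=> //; have [Ls La L0 Ldown] := geo; have Lorb := porbit_const Ls.
have par d : odd (dist Q d) = c d (+) c (og Q).
  have [n] := ubnP (dist Q d); elim: n d => // n IH d Ld.
  have [/eqP d0|/[dup] d0 /Ldown[e de Le]] := posnP (dist Q d).
    by move: (d0); rewrite L0 (eqP d0) => /(porbit_const cs) ->; rewrite addbb.
  have Ld' : dist Q d = (dist Q (al Q e)).+1.
    by have := La (al Q e); rewrite aK (Lorb _ _ de); lia.
  rewrite Ld' /= IH; first by rewrite ca (porbit_const cs de) addNb negbK.
  by lia.
split=> // d; last exact/eqP.
have := La d; have := La (al Q d); rewrite aK.
have : odd (dist Q d) != odd (dist Q (al Q d)).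
  by rewrite !par ca; case: (c d) (c (og Q)) => [] [].
by lia.
Qed.

(** * Orbit counts and the transfer of Euler's formula *)

Section Counting.
Variables (k m : nat) (Q : rpmap k) (M : rpmap m) (g : 'I_m -> 'I_k).
Hypotheses (dq : dist_quad Q) (schQ : schaeffer_rpmap Q M g).
Let lq : labelled_quad (sg Q) (al Q) (dist Q) := proj1 dq.
Let sch : schaeffer_map (sg Q) (al Q) (dist Q) (sg M) (al M) g.
Proof. by case: schQ. Qed.

Lemma card_schaeffer_darts : k = m + m.
Proof.
pose ups := [set d | rising (al Q) (dist Q) d].
have cup : #|ups| = m.
  rewrite -[RHS]card_ord -(card_codom (sch_inj sch)); apply: eq_card => d.
  rewrite inE; apply/idP/codomP => [/(sch_onto sch)[u <-]|[u ->]]; first by exists u.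
  exact: sch_up sch u.
rewrite -[LHS]card_ord -cardsT -(cardsID ups) setTI cup; congr (_ + _).
rewrite -{}cup -(card_imset ups (@perm_inj _ (al Q))); apply: eq_card => d.
rewrite !inE andbT; apply/idP/imsetP => [dd|[e]].
  by exists (al Q d); rewrite ?inE ?(up_edge lq) ?(lq_inv lq).
by rewrite inE => ue ->; rewrite (up_edge lq) negbK.
Qed.

Lemma schaeffer_nedges2 : nedges M * 2 = m.
Proof.
rewrite /nedges (card_porbits_uniform (n := 2)) ?card_ord // => u.
apply: card_porbit2; first exact: schaeffer_inv dq schQ u.
by apply/eqP; apply: schaeffer_fix dq schQ u.
Qed.

Lemma quad_nfaces4 : nfaces Q * 4 = k.
Proof. by rewrite /nfaces (card_porbits_uniform (n := 4)) ?card_ord //; apply: lq_face lq. Qed.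

Lemma nlocmaxE : nlocmax Q =
  #|[set O in porbits (sg Q) | [forall d in O, ~~ rising (al Q) (dist Q) d]]|.
Proof.
apply: eq_card => O; rewrite !inE; congr (_ && _); apply: eq_forallb_in => d _.
by rewrite -(up_edge lq) /rising (lq_inv lq).
Qed.

Lemma schaeffer_nfaces : nfaces M = nlocmax Q.
Proof. by rewrite nlocmaxE; exact: schaeffer_faces lq sch. Qed.

Lemma schaeffer_nvertices : nvertices Q = nvertices M + nfaces M.
Proof. by rewrite schaeffer_nfaces nlocmaxE; exact: schaeffer_vertices sch. Qed.

Lemma schaeffer_nedges : nedges M = nfaces Q.
Proof. by have := card_schaeffer_darts; have := schaeffer_nedges2; have := quad_nfaces4; lia. Qed.

Lemma schaeffer_dist_root : dist M (rt M) = minn (dist Q (rt Q)) (dist Q (al Q (rt Q))).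
Proof.
have [_ gr _] := schQ; rewrite (schaeffer_dist dq schQ) gr /rootLow /minn.
by case: ifP.
Qed.

(** Both maps are connected because they carry a geodesic labeling. As V(Q) = V(M) + F(M) and E(M) =
    F(Q), the two Euler formulas are the same equation. *)
Lemma schaeffer_is_map : is_map M = is_quad Q.
Proof.
have lk k' (A : rpmap k') : (forall x y, linked A x y) -> [forall x, forall y,
    connect (fun a b : 'I_k' => (b == sg A a) || (b == al A a)) x y].
  by move=> c; apply/forallP=> x; apply/forallP=> y; apply: c.
have inv k' (A : rpmap k') : (forall d, al A (al A d) = d) -> (forall d, al A d <> d) ->
    [forall d, (al A (al A d) == d) && (al A d != d)].
  by move=> aK aN; apply/forallP=> d; rewrite aK eqxx; apply/eqP/aN.
have Mconn := geodesic_linked (schaeffer_inv dq schQ) (schaeffer_geodesic dq schQ).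
have Qconn := geodesic_linked (lq_inv lq) (proj2 dq).
have Minv := inv _ _ (schaeffer_inv dq schQ) (schaeffer_fix dq schQ).
have Qfix d : al Q d <> d by move=> ad; have := lq_edge lq d; rewrite ad; lia.
rewrite /is_quad /is_map Minv (inv _ _ (lq_inv lq) Qfix) !lk //=.
have -> : [forall d, #|porbit (fphi Q) d| == 4] by apply/forallP=> d; rewrite (lq_face lq).
rewrite andbT; have := card_schaeffer_darts; have := schaeffer_nvertices.
by have := quad_nfaces4; lia.
Qed.

End Counting.

Lemma exists_schaeffer k (Q : rpmap k) : dist_quad Q ->
  exists m (M : rpmap m) g, schaeffer_rpmap Q M g.
Proof.
move=> [lq [_ _ L0 _]]; pose ups := [set d | rising (al Q) (dist Q) d].
pose g (u : 'I_#|ups|) := enum_val u.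
have g_up u : rising (al Q) (dist Q) (g u) by have := enum_valP u; rewrite inE.
have onto d : rising (al Q) (dist Q) d -> exists u, g u = d.
  move=> ud; have dU : d \in ups by rewrite inE.
  by exists (enum_rank_in dU d); apply: enum_rankK_in.
have /fin_all_exists[ns nsP] u : exists v, fret (sg Q) (rising (al Q) (dist Q)) (g u) (g v).
  have [d ud] := fret_exists (porbit_id (sg Q) (g u)) (g_up u).
  by have [v vd] := onto d (fret_in ud); exists v; rewrite vd.
have ns_inj : injective ns.
  move=> u v uv; apply: enum_val_inj; apply: fret_inj (nsP u) _ => //.
  by rewrite uv; apply: nsP.
have /fin_all_exists[na naP] u : exists v, g v = new_edge (sg Q) (al Q) (dist Q) (g u).
  by apply: onto; apply: new_edge_in.
have na_inj : injective na.
  move=> u v /(congr1 g); rewrite !naP => /(congr1 (new_edge (sg Q) (al Q) (dist Q))).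
  by rewrite !new_edgeK //; apply: enum_val_inj.
have [r gr] := onto _ (up_rootLow lq).
(* A dart of label 0 cannot be decreasing, so the origin dart of Q itself survives in M. *)
have [o go] : exists o, g o = og Q.
  apply: onto; rewrite -[X in is_true X]negbK; apply/negP => /(down_label lq).
  by have := L0 (og Q); rewrite porbit_id => /eqP ->.
exists #|ups|, (perm ns_inj, perm na_inj, r, o), g; split=> //.
  split=> [||//|u|u]; rewrite ?permE //; exact: enum_val_inj.
by rewrite /= go porbit_id.
Qed.

(** * Uniqueness *)

Section Transfer.
Variables (T T' U : finType) (s a : {perm T}) (s' a' : {perm T'}) (sM aM : {perm U}).
Variables (L : T -> nat) (L' : T' -> nat) (g : U -> T) (g' : U -> T').
Hypotheses (lq : labelled_quad s a L) (sch : schaeffer_map s a L sM aM g).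
Hypotheses (lq' : labelled_quad s' a' L') (sch' : schaeffer_map s' a' L' sM aM g').
Hypothesis eqL : forall u, L (g u) = L' (g' u).

(** The four transfer lemmas treat the four types of consecutive darts around a vertex; in each, M
    and the common labels dictate the next dart. *)
Lemma transfer_down_up u u' : s (a (g u)) = g u' -> s' (a' (g' u)) = g' u'.
Proof.
move=> uu'; have us : rising a L (s (a (g u))) by rewrite uu'; apply: sch_up sch u'.
have -> : u' = aM u by apply: (sch_inj sch); rewrite -uu' (rot_down_eq lq sch).
apply: (rot_down_eq lq' sch'); move: us.
by rewrite (rot_down_up lq sch) !eqL -(rot_down_up lq' sch').
Qed.

Lemma transfer_down_down u u' : s (a (g u)) = a (g u') -> s' (a' (g' u)) = a' (g' u').
Proof.
move=> uu'; have := rot_down_up lq sch u; rewrite !eqL -(rot_down_up lq' sch') uu'.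
rewrite (up_edge lq) (sch_up sch) => /esym/negbT/(down_edge lq' sch')[v uv].
rewrite uv; congr (a' (g' _)); apply: fret_fun (face_next_down lq' sch' uv) _.
by apply: eq_fret (face_next_down lq sch uu') => w; rewrite !eqL.
Qed.

Lemma transfer_up_up w y : s (g w) = g y -> s' (g' w) = g' y.
Proof.
move=> wy; have := rotV_up lq sch y.
rewrite -{1}wy permK (sch_up sch) !eqL -(rotV_up lq' sch') => /esym/(sch_onto sch')[v vy].
have svy : s' (g' v) = g' y by rewrite vy permKV.
rewrite -svy; congr (s' (g' _)); apply: (@perm_inj _ sM).
by rewrite (rot_up_eq sch wy) (rot_up_eq sch' svy).
Qed.

End Transfer.

(** That the dart before [a' (g' v)] cannot be decreasing follows from [transfer_down_down] with the
    two quadrangulations exchanged, which is why this lemma stands outside the section. *)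
Lemma transfer_up_down (T T' U : finType) (s a : {perm T}) (s' a' : {perm T'})
    (sM aM : {perm U}) (L : T -> nat) (L' : T' -> nat) g g' :
    labelled_quad s a L -> schaeffer_map s a L sM aM g ->
    labelled_quad s' a' L' -> schaeffer_map s' a' L' sM aM g' ->
    (forall u, L (g u) = L' (g' u)) ->
  forall w v, s (g w) = a (g v) -> s' (g' w) = a' (g' v).
Proof.
move=> lq sch lq' sch' eqL w v wv; have := permKV s' (a' (g' v)).
have [up'|/(down_edge lq' sch')[v' ->]] := boolP (rising a' L' ((s'^-1)%g (a' (g' v)))).
  have [w' <-] := sch_onto sch' up' => w'v; rewrite -w'v; congr (s' (g' _)).
  apply: fret_fun (rot_up_down lq sch wv) _.
  by apply: eq_fret (rot_up_down lq' sch' w'v) => u; rewrite !eqL.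
move=> v'v; have := transfer_down_down lq' sch' lq sch (fsym eqL) v'v.
rewrite -wv => /perm_inj /esym wv'; have := sch_up sch w.
by rewrite wv' (up_edge lq) (sch_up sch).
Qed.

(** The labels of [Q] and [Q'] agree because both are the distance in [M]. The isomorphism matches
    the two halves of the edge attached to each dart of [M]. *)
Lemma schaeffer_quad_unique k k' m (Q : rpmap k) (Q' : rpmap k') (M : rpmap m) g g' :
  dist_quad Q -> dist_quad Q' -> schaeffer_rpmap Q M g -> schaeffer_rpmap Q' M g' ->
  isoQuad Q Q'.
Proof.
move=> dq dq' scQ scQ'; have kk' : k = k'.
  by rewrite (card_schaeffer_darts dq scQ) (card_schaeffer_darts dq' scQ').
have [lq _] := dq; have [lq' _] := dq'; have [sch gr go] := scQ; have [sch' gr' go'] := scQ'.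
have eqL u : dist Q (g u) = dist Q' (g' u).
  by rewrite -(schaeffer_dist dq scQ) (schaeffer_dist dq' scQ').
have eqL' u : dist Q' (g' u) = dist Q (g u) by [].
have /fin_all_exists[h hP] d : exists d', forall u,
    (d = g u -> d' = g' u) /\ (d = al Q (g u) -> d' = al Q' (g' u)).
  have [ud|/(down_edge lq sch)[u ->]] := boolP (rising (al Q) (dist Q) d).
    have [u <-] := sch_onto sch ud; exists (g' u) => v; split=> [/(sch_inj sch)->//|uv].
    by have := sch_up sch u; rewrite uv (up_edge lq) (sch_up sch).
  exists (al Q' (g' u)) => v; split=> [uv|/perm_inj/(sch_inj sch)->//].
  by have := sch_up sch v; rewrite -uv (up_edge lq) (sch_up sch).
have hg u : h (g u) = g' u by apply: (proj1 (hP _ u)).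
have ha u : h (al Q (g u)) = al Q' (g' u) by apply: (proj2 (hP _ u)).
have cases d : (exists u, d = g u) \/ (exists u, d = al Q (g u)).
  have [/(sch_onto sch)[u <-]|/(down_edge lq sch)] := boolP (rising (al Q) (dist Q) d).
    by left; exists u.
  by right.
have h_al d : h (al Q d) = al Q' (h d).
  by case: (cases d) => [] [u ->]; rewrite ?(lq_inv lq) ha hg ?(lq_inv lq').
have h_sg d : h (sg Q d) = sg Q' (h d).
  case: (cases d) => [] [u du]; case: (cases (sg Q d)) => [] [v dv];
    rewrite dv du ?ha ?hg; apply/esym; rewrite du in dv.
  - exact: transfer_up_up lq sch lq' sch' eqL _ _ dv.
  - exact: transfer_up_down lq sch lq' sch' eqL _ _ dv.
  - exact: transfer_down_up lq sch lq' sch' eqL _ _ dv.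
  - exact: transfer_down_down lq sch lq' sch' eqL _ _ dv.
have h_inj : injective h.
  have ng u v : g' u <> al Q' (g' v).
    by move=> uv; have := sch_up sch' u; rewrite uv (up_edge lq') (sch_up sch').
  move=> d e; case: (cases d) => [] [u ->]; case: (cases e) => [] [v ->]; rewrite ?ha ?hg.
  - by move/(sch_inj sch')->.
  - by move/ng.
  - by move/esym/ng.
  - by move/perm_inj/(sch_inj sch')->.
apply/andP; split; first exact/eqP.
apply/existsP; exists [ffun d => h d]; apply/and4P; split.
- by apply/injectiveP => d e; rewrite !ffunE => /h_inj.
- by apply/forallP => d; rewrite !ffunE h_sg h_al !eqxx.
- have : h (rootLow Q) = rootLow Q' by rewrite -gr hg gr'.
  rewrite ffunE /rootLow; do 2![case: ifP => _]; rewrite ?h_al => e; apply/orP;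
  first [by left; apply/eqP | by right; apply/eqP; rewrite -e ?(lq_inv lq')
    | by left; apply/eqP; apply: perm_inj e].
- rewrite ffunE; rewrite -eq_porbit_mem in go'; rewrite -(eqP go') -hg.
  rewrite porbit_sym in go; pose K d := h d \in porbit (sg Q') (h (g (og M))).
  apply: (porbit_ind (K := K) _ _ go).
    by move=> d /porbit_trans; apply; rewrite h_sg porbit_step.
  exact: porbit_id.
Qed.

Lemma schaeffer_map_unique k m m' (Q : rpmap k) (M : rpmap m) (M' : rpmap m') g g' :
  dist_quad Q -> schaeffer_rpmap Q M g -> schaeffer_rpmap Q M' g' -> isoMap M M'.
Proof.
move=> dq scM scM'; have mm' : m = m'.
  by have := card_schaeffer_darts dq scM; have := card_schaeffer_darts dq scM'; lia.
have [sch gr go] := scM; have [sch' gr' go'] := scM'.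
have /fin_all_exists[h hP] u : exists v, g' v = g u.
  exact: (sch_onto sch' (sch_up sch u)).
have inj' := sch_inj sch'.
have h_sg u : h (sg M u) = sg M' (h u).
  apply: inj'; rewrite hP; apply: fret_fun (sch_rot sch u) _.
  by rewrite -hP; apply: sch_rot sch' _.
apply/andP; split; first exact/eqP.
apply/existsP; exists [ffun d => h d]; apply/and4P; split.
- by apply/injectiveP => d e; rewrite !ffunE => /(congr1 g'); rewrite !hP => /(sch_inj sch).
- apply/forallP => d; rewrite !ffunE h_sg eqxx /=; apply/eqP/inj'.
  by rewrite hP (sch_edge sch) (sch_edge sch') hP.
- by rewrite ffunE; apply/eqP/inj'; rewrite hP gr gr'.
- rewrite ffunE -(sch_vertex sch') hP; rewrite -eq_porbit_mem in go'.
  by rewrite (eqP go').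
Qed.

Lemma ord_inj_onto m n (h : 'I_m -> 'I_n) : m = n -> injective h ->
  forall y, exists x, y = h x.
Proof.
by move=> mn; subst n => h_inj y; exists (invF h_inj y); rewrite f_invF.
Qed.

Lemma isoMap_schaeffer k m m' (Q : rpmap k) (M : rpmap m) (M' : rpmap m') g' :
  isoMap M M' -> schaeffer_rpmap Q M' g' -> exists g, schaeffer_rpmap Q M g.
Proof.
case/andP=> /eqP mm' /existsP[h /and4P[/injectiveP h_inj /forallP hP /eqP hr ho]].
have h_sg u : h (sg M u) = sg M' (h u) by have /andP[/eqP] := hP u.
have h_al u : h (al M u) = al M' (h u) by have /andP[_ /eqP] := hP u.
move=> [sch gr go]; exists (fun u => g' (h u)); split; first split.
- by move=> u v /(sch_inj sch)/h_inj.
- by move=> u; apply: sch_up sch _.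
- move=> d /(sch_onto sch)[v <-]; have [u ->] := ord_inj_onto mm' h_inj v.
  by exists u.
- by move=> u; rewrite h_sg; apply: sch_rot sch _.
- by move=> u; rewrite h_al (sch_edge sch).
- by rewrite hr.
- rewrite -(sch_vertex sch) in ho; exact: porbit_trans go ho.
Qed.

Lemma isoQuad_schaeffer k k' m (Q : rpmap k) (Q' : rpmap k') (M : rpmap m) g :
    dist_quad Q -> dist_quad Q' -> isoQuad Q Q' -> schaeffer_rpmap Q M g ->
  exists g', schaeffer_rpmap Q' M g'.
Proof.
move=> [lq geo] [lq' geo'].
case/andP=> /eqP kk' /existsP[h /and4P[/injectiveP h_inj /forallP hP hr ho]].
have h_sg u : h (sg Q u) = sg Q' (h u) by have /andP[/eqP] := hP u.
have h_al u : h (al Q u) = al Q' (h u) by have /andP[_ /eqP] := hP u.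
have h_onto := ord_inj_onto kk' h_inj.
have h_orb d e : (h e \in porbit (sg Q') (h d)) = (e \in porbit (sg Q) d).
  apply/idP/idP => de; last first.
    apply: (porbit_ind (K := fun e => h e \in porbit (sg Q') (h d)) _ _ de).
      by move=> z /porbit_trans; apply; rewrite h_sg porbit_step.
    exact: porbit_id.
  pose K z := exists2 e, z = h e & e \in porbit (sg Q) d.
  suff [z /h_inj ->] : K (h e) by [].
  apply: (porbit_ind (K := K) _ _ de) => [z [x -> dx]|]; last by exists d => //; apply: porbit_id.
  by exists (sg Q x); rewrite ?h_sg //; apply: porbit_trans dx (porbit_step _ _).
have eqL d : dist Q (d) = dist Q' (h d).
  have [Ls La L0 Ldown] := geo'.
  (* The distance of [Q'] pulled back along [h] passes the local test on [Q]. *)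
  apply: (geodesic_dist (lq_inv lq) (L := fun d => dist Q' (h d))); split=> {}d.
  - by rewrite h_sg Ls.
  - by rewrite h_al La.
  - rewrite L0 -h_orb; rewrite -!eq_porbit_mem in ho *.
    by rewrite (eqP ho).
  - move=> /Ldown[e]; have [{}e ->] := h_onto e; rewrite h_orb -h_al => de Le.
    by exists e.
have h_up d : rising (al Q') (dist Q') (h d) = rising (al Q) (dist Q) d.
  by rewrite /rising -h_al -!eqL.
have h_sgV d : h (((sg Q)^-1)%g d) = ((sg Q')^-1)%g (h d).
  by apply: (@perm_inj _ (sg Q')); rewrite -h_sg !permKV.
case=> sch gr go; exists (fun u => h (g u)); split; first split.
- by move=> u v /h_inj/(sch_inj sch).
- by move=> u; rewrite h_up; apply: sch_up sch u.
- by move=> e; have [d ->] := h_onto e; rewrite h_up => /(sch_onto sch)[u <-]; exists u.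
- by move=> u; apply: (fret_morph (h := h) h_sg h_up (sch_rot sch u)).
- move=> u; have hE := (fun d => esym (h_al d), fun d => esym (h_sg d)).
  by rewrite (sch_edge sch) /new_edge -h_sgV !hE !h_up !(fun_if h).
- rewrite gr; have uh : rising (al Q') (dist Q') (h (rootLow Q)) by rewrite h_up up_rootLow.
  have low e : rising (al Q') (dist Q') e -> (e == rt Q') || (e == al Q' (rt Q')) -> e = rootLow Q'.
    move=> ue /orP[/eqP eq|/eqP eq]; move: ue; rewrite eq /rootLow.
      by rewrite /rising => ->.
    by rewrite (up_edge lq') => /negbTE; rewrite /rising => ->.
  apply: low => //; rewrite /rootLow; case: ifP => _; first exact: hr.
  by rewrite h_al; case/orP: hr => /eqP->; rewrite ?(lq_inv lq') eqxx ?orbT.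
- rewrite -h_orb in go; exact: porbit_trans ho go.
Qed.

(** * The inverse construction *)

Lemma fret_level (T : finType) (f : {perm T}) (l : T -> nat) t v x :
    (forall u, l (f u) <= (l u).+1) -> fret f (fun w => t < l w) v x -> l v <= t ->
  l x = t.+1 /\ l ((f^-1)%g x) = t.
Proof.
move=> step vx; elim: vx => {v x} [v tv vt|v x nt _ IH _]; last by apply: IH; rewrite leqNgt.
by rewrite permK; have := step v; lia.
Qed.

Section Closure.
Variables (m : nat) (M : rpmap m).
Local Notation s := (sg M).
Local Notation a := (al M).
Local Notation l := (dist M).
Local Notation f := (fphi M).
Hypotheses (aK : forall u, a (a u) = u) (aN : forall u, a u <> u) (geo : geodesic M l).

Let ls u : l (s u) = l u. Proof. by case: geo. Qed.
Let la u : l (a u) <= (l u).+1. Proof. by case: geo. Qed.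

Lemma face_label u : l (f u) = l (a u).
Proof. by rewrite permM -[in RHS](permKV s (a u)) ls. Qed.

Lemma face_invE v : (f^-1)%g v = a (s v).
Proof. by apply: (@perm_inj _ f); rewrite permKV permM aK permK. Qed.

(* [nx v] is the corner to which the corner [v] is linked in its face, [pv v] the
   preceding corner with the same target. *)
Variables (nx pv : 'I_m -> 'I_m).
Hypothesis nxP : forall v, l ((f^-1)%g v) = (l v).+1 -> fret f (fun w => l v < l w) v (nx v).
Hypothesis pvP : forall v, fret (f^-1)%g (fun w => l v <= l w) v (pv v).

Lemma nx_label v : l ((f^-1)%g v) = (l v).+1 ->
  l (nx v) = (l v).+1 /\ l ((f^-1)%g (nx v)) = l v.
Proof.
by move=> /nxP vx; apply: fret_level vx _ => // u; rewrite face_label.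
Qed.

(** Starting one corner earlier places the starting point in the set returned to, so that [fret_inj]
    and [fret_inv] apply. *)
Lemma nx_from_prev v : l ((f^-1)%g v) = (l v).+1 ->
  fret f (fun w => l v < l w) ((f^-1)%g v) (nx v).
Proof. by move=> pv1; apply: FretSkip; rewrite permKV ?ltnn //; apply: nxP. Qed.

(** Walking backwards, labels also rise by at most one per step, so the first return to level [l v]
    cannot overshoot it. *)
Lemma pv_label v : l ((f^-1)%g v) <> (l v).+1 -> l (pv v) = l v.
Proof.
move=> pv1; have stepV u : l ((f^-1)%g u) <= (l u).+1 by rewrite face_invE -(ls u).
have := pvP v; move ep: (pv v) => p vp.
inversion vp; subst; first by apply/eqP; have := stepV v; lia.
have lf : l ((f^-1)%g v) <= (l v).-1 by lia.
have l0 : 0 < l v by lia.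
have vp' : fret (f^-1)%g (fun w => (l v).-1 < l w) ((f^-1)%g v) (pv v).
  by apply: eq_fret H0 => w; rewrite prednK.
by have [-> _] := fret_level stepV vp' lf; rewrite prednK.
Qed.

Lemma pv_next v : fret f (fun w => l v <= l w) (pv v) v.
Proof. by have := fret_inv (pvP v) (leqnn _); rewrite invgK. Qed.

(* The increasing and decreasing darts of the edge drawn from the corner [u]. *)
Definition dup (u : 'I_m) : 'I_(m + m) := lshift m u.
Definition ddown (u : 'I_m) : 'I_(m + m) := rshift m u.

(* The clockwise rotation of the quadrangulation: unlike its inverse it is given
   by a local rule on increasing darts. *)
Definition tau (x : 'I_(m + m)) : 'I_(m + m) :=
  match split x with
  | inl y => if (l (a y)).+1 == l y then ddown (a y) else dup ((s^-1)%g y)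
  | inr v => if l ((f^-1)%g v) == (l v).+1 then dup (nx v) else ddown (pv v)
  end.

Definition swap (x : 'I_(m + m)) : 'I_(m + m) :=
  match split x with inl y => ddown y | inr v => dup v end.

Definition lab (x : 'I_(m + m)) : nat :=
  match split x with inl y => l y | inr v => (l v).+1 end.

Lemma splitU u : split (dup u) = inl u. Proof. exact: (unsplitK (inl u)). Qed.
Lemma splitD u : split (ddown u) = inr u. Proof. exact: (unsplitK (inr u)). Qed.

Lemma tauU y : tau (dup y) =
  if (l (a y)).+1 == l y then ddown (a y) else dup ((s^-1)%g y).
Proof. by rewrite /tau splitU. Qed.
Lemma tauD v : tau (ddown v) =
  if l ((f^-1)%g v) == (l v).+1 then dup (nx v) else ddown (pv v).
Proof. by rewrite /tau splitD. Qed.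
Lemma labU u : lab (dup u) = l u. Proof. by rewrite /lab splitU. Qed.
Lemma labD u : lab (ddown u) = (l u).+1. Proof. by rewrite /lab splitD. Qed.
Lemma swapU u : swap (dup u) = ddown u. Proof. by rewrite /swap splitU. Qed.
Lemma swapD u : swap (ddown u) = dup u. Proof. by rewrite /swap splitD. Qed.

Lemma dup_inj : injective dup. Proof. exact: lshift_inj. Qed.
Lemma ddown_inj : injective ddown. Proof. exact: rshift_inj. Qed.
Lemma dup_ddown u v : dup u <> ddown v.
Proof. by move/(congr1 (@split _ _)); rewrite splitU splitD. Qed.

Lemma dart_ind (P : 'I_(m + m) -> Prop) :
  (forall u, P (dup u)) -> (forall u, P (ddown u)) -> forall x, P x.
Proof. by move=> PU PD x; case: (split_ordP x) => u ->. Qed.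

Lemma swapK : involutive swap.
Proof. by elim/dart_ind => u; rewrite ?(swapU, swapD). Qed.

Lemma tau_lab x : lab (tau x) = lab x.
Proof.
elim/dart_ind: x => u; rewrite ?tauU ?tauD; case: eqP => [e|ne]; rewrite ?labU ?labD //.
- by rewrite -[in RHS](permKV s u) ls.
- by case: (nx_label e).
- by rewrite pv_label.
Qed.

Lemma tauU_tauD y v : tau (dup y) <> tau (ddown v).
Proof.
rewrite tauU tauD; case: eqP => [ey|ney]; case: eqP => [ev|nev].
- by move/esym/dup_ddown.
- move/ddown_inj => yp; have lp := pv_label nev; have := pv_next v; rewrite -yp in lp *.
  have fp : f (a y) = (s^-1)%g y by rewrite permM aK.
  have lfp : l (f (a y)) = l y by rewrite face_label aK.
  have hit : fret f (fun w => l v <= l w) (a y) (f (a y)).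
    by apply: FretHit; rewrite lfp; lia.
  by move=> /fret_fun/(_ hit) vf; move: lfp; rewrite -vf; lia.
- move/dup_inj => yx; have [lx lfx] := nx_label ev; apply: ney.
  have <- : (f^-1)%g (nx v) = a y by rewrite face_invE -yx permKV.
  by rewrite lfx -lx -yx -[in RHS](permKV s y) ls.
- exact: dup_ddown.
Qed.

Lemma tau_inj : injective tau.
Proof.
elim/dart_ind => u; elim/dart_ind => v.
- rewrite !tauU; case: eqP => _; case: eqP => _; last by move=> /dup_inj/perm_inj->.
  + by move=> /ddown_inj/perm_inj->.
  + by move/esym/dup_ddown.
  + by move/dup_ddown.
- by move/tauU_tauD.
- by move/esym/tauU_tauD.
rewrite !tauD; case: eqP => eu; case: eqP => ev.
- move=> /dup_inj uv; have [lu _] := nx_label eu; have [lv _] := nx_label ev.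
  have luv : l u = l v by apply/succn_inj; rewrite -lu -lv uv.
  have Fu := nx_from_prev eu; have Fv := nx_from_prev ev; rewrite -uv -luv in Fv.
  congr ddown; apply: (@perm_inj _ (f^-1)%g); apply: fret_inj Fu Fv.
    by rewrite eu.
  by rewrite ev luv.
- by move/dup_ddown.
- by move/esym/dup_ddown.
move=> /ddown_inj uv; have lu := pv_label eu; have lv := pv_label ev.
have luv : l u = l v by rewrite -lu uv.
have Fv := pvP v; rewrite -luv -uv in Fv.
by congr ddown; apply: fret_inj (pvP u) Fv; rewrite /= ?luv.
Qed.

Definition closure_map : rpmap (m + m) :=
  ((perm tau_inj)^-1, perm (inv_inj swapK), dup (rt M), dup (og M))%g.

Local Notation Q := closure_map.
Local Notation up := (rising (al Q) lab).

Lemma al_closure x : al Q x = swap x. Proof. by rewrite permE. Qed.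
Lemma sgV_closure x : ((sg Q)^-1)%g x = tau x. Proof. by rewrite invgK permE. Qed.
Lemma sg_tau x : sg Q (tau x) = x. Proof. by rewrite -sgV_closure permKV. Qed.

Lemma upU u : up (dup u). Proof. by rewrite /rising al_closure swapU labU labD. Qed.
Lemma upD u : ~~ up (ddown u).
Proof. by rewrite /rising al_closure swapD labU labD -leqNgt. Qed.

Lemma closure_rot u : fret (sg Q) up (dup u) (dup (s u)).
Proof.
rewrite -[sg Q]invgK; apply: fret_inv (upU _).
have [z uz] := fret_exists (porbit_id ((sg Q)^-1)%g (dup (s u))) (upU _).
(* Clockwise from [dup (s u)], every dart met before [dup u] is the head of an edge linked to the
   corner [u], taken in the backward order of the face. *)
pose I w := w = dup (s u) \/
  exists v, [/\ w = ddown v, fret f (fun w => l v < l w) v u & (l v).+1 = l u].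
have step w : I w -> tau w = dup u \/ ~~ up (tau w) /\ I (tau w).
  case=> [->|[v [-> vu lv]]].
    rewrite tauU permK ls; case: eqP => e; [right | by left].
    split; first exact: upD.
    right; exists (a (s u)); split=> //.
    have fu : f (a (s u)) = u by rewrite -face_invE permKV.
    have := @FretHit _ f (fun w => l (a (s u)) < l w) (a (s u)); rewrite fu; apply.
    by rewrite -e.
  rewrite tauD; case: eqP => e; [left|right].
    by rewrite (fret_fun (nxP e) vu).
  split; first exact: upD.
  have lp := pv_label e; right; exists (pv v); rewrite lp; split=> //.
  by apply: fret_sub (pv_next v) _ vu; [move=> x /ltnW | rewrite ltnn].
suff /(_ uz (or_introl erefl)) <- :
    fret ((sg Q)^-1)%g up (dup (s u)) z -> I (dup (s u)) -> z = dup u by [].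
move=> {uz}; elim=> {z} [w uw|w z nuw _ IH] /step; rewrite -sgV_closure.
  by case=> // -[]; rewrite uw.
by case=> [wu|[_ /IH]] //; rewrite wu upU in nuw.
Qed.

Lemma closure_geodesic : geodesic Q lab.
Proof.
have labs x : lab (sg Q x) = lab x by rewrite -[in RHS](permK (sg Q) x) sgV_closure tau_lab.
have [_ _ l0 ldown] := geo.
have orbU u v : v \in porbit s u -> dup v \in porbit (sg Q) (dup u).
  apply: (porbit_ind (K := fun v => dup v \in porbit (sg Q) (dup u))); last exact: porbit_id.
  by move=> w uw; apply: porbit_trans uw (fret_porbit (closure_rot w)).
split=> //.
- by elim/dart_ind => u; rewrite al_closure ?swapU ?swapD ?labU ?labD //; lia.
- elim/dart_ind => u; rewrite ?labU ?labD.
    apply/eqP/idP => [/eqP|/(porbit_const labs)]; first by rewrite l0 => /orbU.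
    by rewrite !labU => ->; apply/eqP; rewrite l0 porbit_id.
  apply/esym/negbTE/negP => /(porbit_const labs); rewrite labU labD.
  by move/eqP: (l0 (og M)); rewrite porbit_id => /eqP/eqP ->.
- elim/dart_ind => u; last by exists (ddown u); rewrite ?porbit_id // al_closure swapD labU labD.
  rewrite labU => /ldown[y uy ly].
  have lyu : l y = l u by apply: porbit_const uy.
  have ey : (l (a y)).+1 = l y by have := la (a y); rewrite aK; lia.
  (* Descending in M along [y] becomes, in the closure, the decreasing dart just clockwise of
     [dup y]. *)
  have ty : tau (dup y) = ddown (a y) by rewrite tauU ey eqxx.
  exists (tau (dup y)); last by rewrite al_closure ty swapD labU.
  apply: porbit_trans (orbU _ _ uy) _.
  by rewrite -sgV_closure -porbitV porbit_step.
Qed.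

Lemma fphi_closure x : fphi Q x = tau (swap x).
Proof. by rewrite permM al_closure sgV_closure. Qed.

Lemma card_face_step x : #|porbit (fphi Q) (fphi Q x)| = #|porbit (fphi Q) x|.
Proof. by have := porbit_perm (fphi Q) 1 x; rewrite expg1 => ->. Qed.

(** The whole boundary of the simple face built on an edge of M along which the label changes. *)
Lemma face_rise y : (l (a y)).+1 = l y ->
  [/\ fphi Q (ddown (a y)) = dup (f y), fphi Q (dup (f y)) = dup (nx (f y)),
      fphi Q (dup (nx (f y))) = ddown y & fphi Q (ddown y) = ddown (a y)].
Proof.
move=> ly; have ey : l ((f^-1)%g (f y)) = (l (f y)).+1 by rewrite permK face_label.
have [lx lfx] := nx_label ey.
rewrite !fphi_closure !swapD !swapU !tauU !tauD aK permM; split.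
- by case: eqP => // e; lia.
- by rewrite -[(s^-1)%g (a y)]permM -/f ey eqxx.
- rewrite -[(s^-1)%g (a y)]permM -/f; case: eqP => [|_]; first by rewrite lfx lx; lia.
  congr ddown; have := nx_from_prev ey; rewrite permK => /fret_inv yx.
  apply: fret_fun (pvP _) _; apply: eq_fret (yx _); last by rewrite face_label ly.
  by move=> w; rewrite lx.
- by rewrite ly eqxx.
Qed.

(** Half the boundary of a confluent face; the same statement for [a y] gives the other half. *)
Lemma face_flat y : l (a y) = l y ->
  fphi Q (ddown y) = dup (f (a y)) /\ fphi Q (dup (f (a y))) = ddown (a y).
Proof.
move=> ly; have fy : f (a y) = (s^-1)%g y by rewrite permM aK.
rewrite !fphi_closure !swapD !swapU !tauU !tauD; split.
  by rewrite fy; case: eqP => // e; lia.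
have lf : l (f (a y)) = l (a y) by rewrite face_label aK ly.
rewrite permK lf; case: eqP => [|_]; first by lia.
congr ddown; apply: fret_fun (pvP _) _.
have := @FretHit _ (f^-1)%g (fun w => l (f (a y)) <= l w) (f (a y)).
by rewrite permK; apply; rewrite lf.
Qed.

Lemma closure_faces x : #|porbit (fphi Q) x| = 4.
Proof.
have rise y : (l (a y)).+1 = l y -> #|porbit (fphi Q) (ddown (a y))| = 4.
  move=> /face_rise[e1 e2 e3 e4]; apply/eqP/card_porbit4P.
  by rewrite e1 e2 e3 e4; split=> //; apply: dup_ddown.
have faceD u : #|porbit (fphi Q) (ddown u)| = 4.
  have := la u; have := la (a u); rewrite aK => l1 l2.
  have [lt|lt|eq] := ltngtP (l (a u)) (l u).
  - have e : (l (a u)).+1 = l u by lia.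
    by rewrite -(rise u e); have [_ _ _ <-] := face_rise e; rewrite card_face_step.
  - by rewrite -[u]aK rise // aK; lia.
  have [e1 e2] := face_flat eq; have [|e3 e4] := @face_flat (a u); first by rewrite aK.
  rewrite aK in e3 e4; apply/eqP/card_porbit4P; rewrite e1 e2 e3 e4.
  by split=> // /ddown_inj/aN.
elim/dart_ind: x => // x; have [e|ne] := eqVneq (l ((f^-1)%g x)) (l x).+1.
  have ly : (l (a ((f^-1)%g x))).+1 = l ((f^-1)%g x) by rewrite e -face_label permKV.
  have [+ _ _ _] := face_rise ly; rewrite permKV => <-.
  by rewrite card_face_step.
by rewrite -card_face_step fphi_closure swapU tauD (negbTE ne).
Qed.

Lemma closure_edge u : new_edge (sg Q) (al Q) lab (dup u) = dup (a u).
Proof.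
rewrite /new_edge sgV_closure tauU; case: eqP => [e|ne].
  by rewrite (upD (a u)) al_closure swapD.
rewrite upU /= al_closure swapU.
have := la u; rewrite leq_eqVlt => /orP[/eqP e|].
  have <- : tau (dup (a u)) = ddown u by rewrite tauU aK e eqxx.
  by rewrite sg_tau upU.
rewrite ltnS => lau; have eq : l (a u) = l u by have := la (a u); rewrite aK; lia.
have [|e1 e2] := @face_flat (a u); first by rewrite aK.
rewrite aK fphi_closure swapU in e2; rewrite aK fphi_closure swapD in e1.
have -> : sg Q (ddown u) = ddown (f u) by rewrite -e2 sg_tau.
by rewrite (negbTE (upD _)) al_closure swapD -e1 sg_tau.
Qed.

Lemma closure_dist x : dist Q x = lab x.
Proof.
by apply: (geodesic_dist _ closure_geodesic) => d; rewrite !al_closure swapK.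
Qed.

Lemma closure_dist_quad : dist_quad Q.
Proof.
have [Ls La L0 Ldown] := closure_geodesic; split; split.
- by move=> x; rewrite !al_closure swapK.
- by move=> x; rewrite !closure_dist.
- move=> x; rewrite !closure_dist al_closure.
  by elim/dart_ind: x => u; rewrite ?swapU ?swapD labU labD eqxx ?orbT.
- exact: closure_faces.
- by move=> x; rewrite !closure_dist.
- by move=> x; rewrite !closure_dist.
- by move=> x; rewrite closure_dist.
- by move=> x; rewrite closure_dist => /Ldown[e xe Le]; exists e => //; rewrite closure_dist.
Qed.

Lemma closure_schaeffer : schaeffer_rpmap Q M dup.
Proof.
have upE : rising (al Q) (dist Q) =1 up by move=> x; rewrite /rising !closure_dist.
split; last exact: porbit_id; first split.
- exact: dup_inj.
- by move=> u; rewrite upE upU.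
- by elim/dart_ind => u; rewrite upE ?(negbTE (upD u)) // => _; exists u.
- by move=> u; apply: eq_fret (closure_rot u) => x; rewrite upE.
- by move=> u; rewrite -closure_edge /new_edge !upE.
by rewrite /rootLow; have := upU (rt M); rewrite -upE /rising => ->.
Qed.

End Closure.

Lemma exists_quad m (M : rpmap m) : is_map M ->
  exists k (Q : rpmap k) g, dist_quad Q /\ schaeffer_rpmap Q M g.
Proof.
case/andP=> /andP[/forallP aKN /forallP conn] _.
have aK d : al M (al M d) = d by have /andP[/eqP] := aKN d.
have aN d : al M d <> d by have /andP[_ /eqP] := aKN d.
have geo : geodesic M (dist M).
  by apply: dist_geodesic => // x y; have /forallP := conn x; apply.
have /fin_all_exists[nx nxP] v : exists x, dist M (((fphi M)^-1)%g v) = (dist M v).+1 ->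
    fret (fphi M) (fun w => dist M v < dist M w) v x.
  have [e|ne] := eqVneq (dist M (((fphi M)^-1)%g v)) (dist M v).+1; last first.
    (* A dummy value: the specification is vacuous here. *)
    by exists v => e; rewrite e eqxx in ne.
  have orb : ((fphi M)^-1)%g v \in porbit (fphi M) v by rewrite -porbitV porbit_step.
  have [|x vx] := @fret_exists _ _ (fun w => dist M v < dist M w) _ _ orb.
    by rewrite e.
  by exists x.
have /fin_all_exists[pv pvP] v : exists p,
    fret ((fphi M)^-1)%g (fun w => dist M v <= dist M w) v p.
  exact: fret_exists (porbit_id _ v) (leqnn _).
exists (m + m), (closure_map aK geo nxP pvP), (@dup m); split.
  exact: closure_dist_quad.
exact: closure_schaeffer.
Qed.

(** * Counting isomorphism classes *)

(** [F] is a relation because the image map is determined only up to isomorphism. That [R] and [R']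
    behave as equivalences on the selected maps is derived from the hypotheses on [F]. *)
Lemma nclasses_eq k m (P : pred (rpmap k)) (P' : pred (rpmap m)) (R : rel (rpmap k))
    (R' : rel (rpmap m)) (F : rpmap k -> rpmap m -> Prop) :
    (forall a, P a -> exists2 b, P' b & F a b) ->
    (forall b, P' b -> exists2 a, P a & F a b) ->
    (forall a a' b, P a -> P a' -> P' b -> F a b -> F a' b -> R a a') ->
    (forall a b b', P a -> P' b -> P' b' -> F a b -> F a b' -> R' b b') ->
    (forall a a' b, P a -> P a' -> P' b -> R a a' -> F a b -> F a' b) ->
    (forall a b b', P a -> P' b -> P' b' -> R' b b' -> F a b' -> F a b) ->
  nclasses P R = nclasses P' R'.
Proof.
rewrite /nclasses => FA FB RF R'F FR FR'.
have Rrefl a : P a -> R a a.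
  by move=> Pa; have [b P'b ab] := FA _ Pa; exact (RF _ _ _ Pa Pa P'b ab ab).
have R'refl b : P' b -> R' b b.
  by move=> P'b; have [a Pa ab] := FB _ P'b; exact (R'F _ _ _ Pa P'b P'b ab ab).
have R'sym b b' : P' b -> P' b' -> R' b b' -> R' b' b.
  move=> P'b P'b' bb'; have [a Pa ab] := FB _ P'b'.
  by apply: (R'F a) => //; apply: FR' ab.
have clE a a' : P a -> P a' ->
    ([set y | P y && R a y] == [set y | P y && R a' y]) = R a a'.
  move=> Pa Pa'; apply/eqP/idP => [/setP/(_ a')|aa'].
    by rewrite !inE Pa' Rrefl.
  apply/setP=> x; rewrite !inE; apply: andb_id2l => Px.
  have [b P'b ab] := FA _ Pa; have a'b : F a' b by apply: FR ab.
  by apply/idP/idP => [ax|ax]; apply: (RF _ _ b) => //; [apply: FR ab | apply: FR a'b].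
have cl'E b b' : P' b -> P' b' ->
    ([set y | P' y && R' b y] == [set y | P' y && R' b' y]) = R' b b'.
  move=> Pb Pb'; apply/eqP/idP => [/setP/(_ b')|bb'].
    by rewrite !inE Pb' R'refl.
  apply/setP=> x; rewrite !inE; apply: andb_id2l => Px.
  have [a Pa ax] := FB _ Px.
  apply/idP/idP => [bx|b'x].
    have ab : F a b by apply: FR' ax.
    by apply: (R'F a) => //; apply: FR' ab => //; apply: R'sym.
  have ab' : F a b' by apply: FR' ax.
  by apply: (R'F a) => //; apply: FR' ab'.
(* After choosing one image for each source map, both sets of classes are indexed by the source
   maps, and it remains to compare fibres. *)
have /fin_all_exists[e eP] (x : {a : rpmap k | P a}) : exists b, P' b /\ F (val x) b.
  by have [b P'b xb] := FA _ (valP x); exists b.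
pose cl (x : {a : rpmap k | P a}) := [set y | P y && R (val x) y].
pose cl' (x : {a : rpmap k | P a}) := [set y | P' y && R' (e x) y].
have -> : [set [set y | P y && R x y] | x in [set x | P x]] = cl @: setT.
  apply/setP=> C; apply/imsetP/imsetP => [[x]|[x _ ->]].
    by rewrite inE => Px ->; exists (exist _ x Px).
  by exists (val x) => //; rewrite inE (valP x).
have -> : [set [set y | P' y && R' x y] | x in [set x | P' x]] = cl' @: setT.
  apply/setP=> C; apply/imsetP/imsetP => [[b]|[x _ ->]]; last first.
    by exists (e x) => //; have [P'e _] := eP x; rewrite inE.
  rewrite inE => P'b ->; have [a Pa ab] := FB _ P'b; exists (exist _ a Pa) => //.
  by apply/eqP; have [P'e ae] := eP (exist _ a Pa); rewrite cl'E //; apply: (R'F a).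
apply: card_imset_eq => x y _ _; have [P'x xe] := eP x; have [P'y ye] := eP y.
have Px := valP x; have Py := valP y; rewrite clE // cl'E //; apply/idP/idP => xy.
  by apply: (R'F (val y)) => //; apply: FR xy xe.
by apply: (RF _ _ (e x)) => //; apply: FR' ye.
Qed.

Theorem theorem2 :
  (* Phi is defined on every rooted pointed quadrangulation, with value a
     rooted pointed planar map with at least one edge *)
  (forall k (Q : rpmap k), is_quad Q ->
     exists m (M : rpmap m), [&& is_map M & 0 < m] /\ PhiRel Q M) /\
  (* Phi is well defined and injective on isomorphism classes *)
  (forall k m k' m' (Q : rpmap k) (M : rpmap m) (Q' : rpmap k') (M' : rpmap m'),
     is_quad Q -> is_quad Q' -> PhiRel Q M -> PhiRel Q' M' ->
     (isoQuad Q Q' <-> isoMap M M')) /\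
  (* Phi is surjective onto rooted pointed planar maps with >= 1 edge *)
  (forall m (M : rpmap m), is_map M -> 0 < m ->
     exists k (Q : rpmap k), is_quad Q /\ PhiRel Q M) /\
  (* (i), (ii), (iii) *)
  (forall k m (Q : rpmap k) (M : rpmap m), is_quad Q -> PhiRel Q M ->
     [/\ nedges M = nfaces Q,
         nfaces M = nlocmax Q
       & dist M (rt M) = minn (dist Q (rt Q)) (dist Q (al Q (rt Q)))]) /\
  (* enumerative consequence *)
  (forall N n t : nat,
     nclasses (fun M : rpmap (2 * N) =>
                 [&& is_map M, 0 < 2 * N, nfaces M == n & dist M (rt M) == t])
              (@isoMap _ _)
     = nclasses (fun Q : rpmap (4 * N) =>
                 [&& is_quad Q, nfaces Q == N, nlocmax Q == n &
                     minn (dist Q (rt Q)) (dist Q (al Q (rt Q))) == t])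
              (@isoQuad _ _)).
Proof.
have dqP := is_quad_dist_quad.
have relP k m (Q : rpmap k) (M : rpmap m) :
    is_quad Q -> PhiRel Q M <-> exists g, schaeffer_rpmap Q M g.
  by move=> /dqP[lq _]; apply: PhiRel_schaeffer.
(* The root dart itself witnesses that there is at least one edge. *)
have pos k (A : rpmap k) : 0 < k by apply: leq_ltn_trans (ltn_ord (rt A)).
have onto m (M : rpmap m) : is_map M ->
    exists k (Q : rpmap k) g, is_quad Q /\ schaeffer_rpmap Q M g.
  move=> mapM; have [k [Q [g [dq sch]]]] := exists_quad mapM.
  by exists k, Q, g; rewrite -(schaeffer_is_map dq sch).
have defd k (Q : rpmap k) : is_quad Q ->
    exists m (M : rpmap m) g, is_map M /\ schaeffer_rpmap Q M g.
  move=> quadQ; have [m [M [g sch]]] := exists_schaeffer (dqP _ _ quadQ).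
  by exists m, M, g; rewrite (schaeffer_is_map (dqP _ _ quadQ) sch).
split; [|split; [|split; [|split]]].
- move=> k Q quadQ; have [m [M [g [mapM sch]]]] := defd _ _ quadQ.
  by exists m, M; rewrite mapM (pos _ M); split=> //; apply/relP => //; exists g.
- move=> k m k' m' Q M Q' M' quadQ quadQ' /(relP _ _ _ _ quadQ)[g sch].
  move=> /(relP _ _ _ _ quadQ')[g' sch'].
  have dq := dqP _ _ quadQ; have dq' := dqP _ _ quadQ'; split=> iso.
    have [h sch2] := isoQuad_schaeffer dq dq' iso sch.
    exact: schaeffer_map_unique dq' sch2 sch'.
  have [h sch2] := isoMap_schaeffer iso sch'.
  exact: schaeffer_quad_unique dq dq' sch sch2.
- move=> m M /onto[k [Q [g [quadQ sch]]]] _; exists k, Q; split=> //.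
  by apply/relP => //; exists g.
- move=> k m Q M quadQ /(relP _ _ _ _ quadQ)[g sch]; have dq := dqP _ _ quadQ.
  split; first exact: schaeffer_nedges dq sch.
    exact: schaeffer_nfaces dq sch.
  exact: schaeffer_dist_root dq sch.
move=> N n t; apply/esym.
(* The statistics on the two sides coincide; the face count of Q is forced by its [4 * N] darts. *)
have same (Q : rpmap (4 * N)) (M : rpmap (2 * N)) g : is_quad Q -> schaeffer_rpmap Q M g ->
    [&& nfaces Q == N, nlocmax Q == n & minn (dist Q (rt Q)) (dist Q (al Q (rt Q))) == t]
    = [&& 0 < 2 * N, nfaces M == n & dist M (rt M) == t].
  move=> quadQ sch; have dq := dqP _ _ quadQ.
  rewrite (pos _ M) (schaeffer_nfaces dq sch) (schaeffer_dist_root dq sch).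
  suff /eqP -> : nfaces Q == N by rewrite eqxx.
  by have := quad_nfaces4 dq; lia.
apply: (nclasses_eq (F := fun Q M => exists g, schaeffer_rpmap Q M g)).
- move=> Q /andP[quadQ PQ]; have [m [M [g [mapM sch]]]] := defd _ _ quadQ.
  have mN : m = 2 * N by have := card_schaeffer_darts (dqP _ _ quadQ) sch; lia.
  subst m; exists M; last by exists g.
  by rewrite mapM -(same _ _ _ quadQ sch).
- move=> M /andP[mapM PM]; have [k [Q [g [quadQ sch]]]] := onto _ _ mapM.
  have kN : k = 4 * N by have := card_schaeffer_darts (dqP _ _ quadQ) sch; lia.
  subst k; exists Q; last by exists g.
  by rewrite quadQ (same _ _ _ quadQ sch).
- move=> Q Q' M /andP[/dqP dq _] /andP[/dqP dq' _] _ [g sch] [g' sch'].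
  exact: schaeffer_quad_unique dq dq' sch sch'.
- move=> Q M M' /andP[/dqP dq _] _ _ [g sch] [g' sch'].
  exact: schaeffer_map_unique dq sch sch'.
- move=> Q Q' M /andP[/dqP dq _] /andP[/dqP dq' _] _ iso [g sch].
  exact: isoQuad_schaeffer dq dq' iso sch.
- move=> Q M M' _ _ _ iso [g sch]; exact: isoMap_schaeffer iso sch.
Qed.
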